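(* Let $F$ be a cellular automaton on $A^{\mathbb Z}$ and $\mu$ a $\sigma$-ergodic, $F$-invariant Borel probability measure. Then for every pair of reals $v=(v^+,v^-)$ with $v^\pm\ge0$, $$h_\mu(F)\ge h_\mu(\sigma)\,(v^++v^-)\,M_\mu(v).$$
   Context: $A$ is a finite alphabet and $\sigma(x)_i=x_{i+1}$. $F$ is a cellular automaton of radius $r$, i.e. $F(x)_i=f(x_{i-r},\dots,x_{i+r})$. $h_\mu$ denotes measure-theoretic entropy. For $p\ge0$: ${}^{\{n\}}\alpha_p^F(x)=\{y:F^i(y)_j=F^i(x)_j\ \forall0\le i\le n,\ |j|\le p\}$. A speed $G$ consists of functions $g^\pm_n:A^{\mathbb Z}\to\mathbb N$, nondecreasing in $n$, with $g^+_n+g^-_n\to\infty$. Set $|G_n(x)|=g^+_n(x)+g^-_n(x)+1$ and $J_n(x)=\{j:-g^+_n(x)-p\le j\le g^-_n(x)+p\}$. For $y\in A^{\mathbb Z}$, ${}^{G_n(x)}\alpha_p^\sigma(y)=\{z:z_j=y_j\ \forall j\in J_n(x)\}$. For $0<\delta<1$, $\eta_{n,\delta}$ is the infimum of $\varepsilon>0$ such that some measurable $S$ with $\mu(S)\ge1-\delta$ satisfies $$\Big|\frac{-\log\mu({}^{G_i(x)}\alpha_p^\sigma(x))}{|G_i(x)|}-h_\mu(\sigma)\Big|<\varepsilon\quad\text{for all } x\in S,\ i\ge n.$$ $X^G_{n,\delta,p}$ is the set of $x$ for which this quantity, taken with $i=n$, is $\le\eta_{n,\delta}$. $\langle T^G_{n,p}(x)\rangle=\{z|_{J_n(x)}:z\in{}^{\{n\}}\alpha_p^F(x)\}$,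 and $T^G_{n,p}(x)$ is the union of the cylinders $\{z:z|_{J_n(x)}=w\}$ over these $w$. $T^G_{n,\delta,p}(x)=T^G_{n,p}(x)\cap X^G_{n,\delta,p}$ and $\langle T^G_{n,\delta,p}(x)\rangle=\{z|_{J_n(x)}:z\in T^G_{n,\delta,p}(x)\}$. Density flow: $$M_{n,p,\delta}(G)=\int\Big(1-\frac{\log\#\langle T^G_{n,\delta,p}(x)\rangle}{-\log\mu({}^{G_n(x)}\alpha_p^\sigma(x))}\Big)d\mu(x),\qquad M_\mu(G)=\sup_p\limsup_{\delta\to0}\limsup_{n\to\infty}M_{n,p,\delta}(G).$$ For reals $v^\pm\ge0$, $M_\mu(v)$ denotes $M_\mu(G)$ for $g^\pm_n=\lceil v^\pm n\rceil$.
   Formalization: In the density flow, where the set of words ⟨T_{n,δ,p}(x)⟩ is empty the logarithm of its cardinality, undefined in the text, is taken to be 0 (the integrand is then 1); with log 0 = −∞ the inequality would fail, e.g. for F = σ and v = (0,1). *)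

(* Defs.v *)
From HB Require Import structures.
From mathcomp Require Import all_boot all_order all_algebra.
From mathcomp Require Import all_classical all_reals all_analysis.
Set Implicit Arguments.
Unset Strict Implicit.
Unset Printing Implicit Defensive.
Import Order.TTheory GRing.Theory Num.Theory.
Local Open Scope classical_set_scope.
Local Open Scope ring_scope.

(* Configuration space A^Z.  The extra argument a0 : A only serves to   *)
(* equip the type with the pointedType structure required by           *)
(* MathComp-Analysis measurable types (A is nonempty).                 *)
Definition conf (A : finType) (a0 : A) := int -> A.

HB.instance Definition _ (A : finType) (a0 : A) := Choice.on (@conf A a0).
HB.instance Definition _ (A : finType) (a0 : A) :=
  isPointed.Build (@conf A a0) (fun _ => a0).

Definition cylinders (A : finType) (a0 : A) : set (set (@conf A a0)) :=
  [set C | exists (lo : int) (L : nat) (w : 'I_L -> A),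
           C = [set x | forall k : 'I_L, x (lo + (k : nat)%:Z) = w k]].

(* A^Z with its Borel sigma-algebra (= sigma-algebra generated by the
   cylinders, A discrete, product topology). *)
Definition Conf (A : finType) (a0 : A) := g_sigma_algebraType (@cylinders A a0).

Definition sshift (A : finType) (a0 : A) (x : @Conf A a0) : @Conf A a0 :=
  fun i => x (i + 1).

Definition CA (A : finType) (a0 : A) (r : nat) (f : ('I_(2 * r).+1 -> A) -> A)
  (x : @Conf A a0) : @Conf A a0 :=
  fun i => f (fun k : 'I_(2 * r).+1 => x (i - r%:Z + (k : nat)%:Z)).

Section Dynamics.
Context (R : realType) (A : finType) (a0 : A).
Local Notation X := (@Conf A a0).
Context (mu : probability X R).

Definition mu_invariant (T : X -> X) :=
  forall S : set X, measurable S -> mu (T @^-1` S) = mu S.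

Definition mu_ergodic (T : X -> X) :=
  mu_invariant T /\
  forall S : set X, measurable S -> T @^-1` S = S -> mu S = 0%E \/ mu S = 1%E.

Definition is_partition (k : nat) (P : 'I_k -> set X) :=
  [/\ forall i, measurable (P i),
      forall i j, i != j -> P i `&` P j = set0 &
      forall x, exists i, P i x].

Definition plogp (t : R) : R := if t == 0 then 0 else t * ln t.

Definition Hfam (I : finType) (Q : I -> set X) : R :=
  - \sum_(i : I) plogp (fine (mu (Q i))).

Definition join (T : X -> X) (k n : nat) (P : 'I_k -> set X)
  (w : {ffun 'I_n -> 'I_k}) : set X :=
  [set x | forall i : 'I_n, P (w i) (iter i T x)].

(* h_mu(T, P) = lim (1/n) H(join) (the limit exists; we take limsup) *)
Definition h_part (T : X -> X) (k : nat) (P : 'I_k -> set X) : \bar R :=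
  limn_esup (fun n => (Hfam (@join T k n P) / n%:R)%:E).

Definition h_mu (T : X -> X) : \bar R :=
  ereal_sup [set e | exists (k : nat) (P : 'I_k -> set X),
                       is_partition P /\ e = h_part T P].

Section DensityFlow.
Context (F : X -> X) (gp gm : nat -> X -> nat).

Definition Jlo (n p : nat) (x : X) : int := - (gp n x)%:Z - p%:Z.
Definition Jhi (n p : nat) (x : X) : int := (gm n x)%:Z + p%:Z.
Definition Jlen (n p : nat) (x : X) : nat := (gp n x + gm n x + 2 * p).+1.

Definition Gcyl (n p : nat) (x y : X) : set X :=
  [set z | forall j : int, Jlo n p x <= j <= Jhi n p x -> z j = y j].

Definition Gsize (n : nat) (x : X) : R := (gp n x + gm n x + 1)%:R.

Definition ratio (p i : nat) (x : X) : R :=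
  - ln (fine (mu (Gcyl i p x x))) / Gsize i x.

Definition eta (p n : nat) (delta : R) : \bar R :=
  ereal_inf [set e%:E | e in [set e : R | 0 < e /\
     exists S : set X, [/\ measurable S, ((1 - delta)%:E <= mu S)%E &
       forall x, S x -> forall i, (n <= i)%N ->
         `|ratio p i x - fine (h_mu (@sshift A a0))| < e]]].

Definition XG (n : nat) (delta : R) (p : nat) : set X :=
  [set x | ((`|ratio p n x - fine (h_mu (@sshift A a0))|)%:E <= eta p n delta)%E].

Definition alphaF (n p : nat) (x : X) : set X :=
  [set y | forall i, (i <= n)%N -> forall j : int, `|j| <= p%:Z ->
                     iter i F y j = iter i F x j].

Definition restr (n p : nat) (x z : X) : {ffun 'I_(Jlen n p x) -> A} :=
  [ffun k : 'I_(Jlen n p x) => z (Jlo n p x + (k : nat)%:Z)].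

Definition TG (n p : nat) (x : X) : set X :=
  [set z | exists y, alphaF n p x y /\ restr n p x y = restr n p x z].

Definition TGwords (n : nat) (delta : R) (p : nat) (x : X)
  : {set {ffun 'I_(Jlen n p x) -> A}} :=
  [set w | `[< exists z, (TG n p x `&` XG n delta p) z /\ restr n p x z = w >]].

Definition Mnpd (n p : nat) (delta : R) : \bar R :=
  \int[mu]_x (1 - ln (#|TGwords n delta p x|%:R)
                    / (- ln (fine (mu (Gcyl n p x x)))))%:E.

Definition limsup_delta0 (g : R -> \bar R) : \bar R :=
  ereal_inf [set ereal_sup (g @` [set d | 0 < d < e]) | e in [set e : R | 0 < e <= 1]].

Definition M_mu : \bar R :=
  ereal_sup [set limsup_delta0 (fun delta => limn_esup (fun n => Mnpd n p delta))
            | p in [set: nat]].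

End DensityFlow.

Definition M_mu_v (F : X -> X) (vp vm : R) : \bar R :=
  M_mu F (fun n _ => `|Num.ceil (vp * n%:R)|%N) (fun n _ => `|Num.ceil (vm * n%:R)|%N).

End Dynamics.

(* Main.v *)
(* Let h be the entropy rate of words.  Compare the entropy of the word of x in
   the window J_n, at least |J_n| h, with that of the space-time word
   (F^i(x)_j), i <= n, |j| <= p: given the latter, the former takes at most
   #<T_{n,delta,p}(x)> values, apart from points outside X_{n,delta,p}, of mass at
   most delta.  Hence the mean of log #<T_{n,delta,p}(x)> is at least
   |J_n| h - n h_mu(F) - O(delta n) - o(n).  Since -log mu(cylinder of x) is at most
   |J_n| (h + eps) outside a set of small measure, dividing by it bounds the density
   flow.  That last bound is the only half of the Shannon-McMillan theorem needed, and
   h_mu(sigma) <= h is the half of the Kolmogorov-Sinai theorem needed. *)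

(* An upper bound on the density flow needs the quotient of the logarithm of the number of words by
   the information of the window from below. The numerator is bounded below in mean and the
   denominator above pointwise; on the exceptional set the integrand is still at most 1. As [h] is
   an infimum, the bound [|J_n| h] on the entropy of the window word carries no error term. Since
   [h_mu(sigma)] stands on the smaller side, it may be replaced by [h], which then cancels against
   the [h] in the denominator.

   Where one would condition one variable on another, Gibbs' inequality is applied to explicit
   weights, which act as a code for the pair. The convention [ln 0 = 0] makes null values look
   certain, so positivity of probabilities is carried along wherever information is bounded. *)
Require Import Defs.
From HB Require Import structures.
From mathcomp Require Import all_boot all_order all_algebra.
From mathcomp Require Import all_classical all_reals all_analysis measurable_realfun.
From mathcomp Require Import ring lra zify.
Import Order.TTheory GRing.Theory Num.Theory numFieldNormedType.Exports.
Local Open Scope classical_set_scope.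
Local Open Scope ring_scope.
Set Implicit Arguments.
Unset Strict Implicit.
Unset Printing Implicit Defensive.

(** * Entropy of finite-valued random variables *)

Section FiniteVariables.
Context (d : measure_display) (X : measurableType d) (R : realType).
Context (mu : probability X R).

Definition mean (g : X -> R) : R := \int[mu]_x g x.

(** Boundedness makes every mean below a real number, so sums and products need no separate
    integrability argument. *)
Definition bmeas (g : X -> R) :=
  measurable_fun setT g /\ exists B : R, forall x, `|g x| <= B.

Lemma bmeas_integrable (g : X -> R) : bmeas g -> mu.-integrable setT (EFin \o g).
Proof.
move=> [mg [B gB]]; apply: measurable_bounded_integrable => //.
  exact: fin_num_fun_lty.
exists B; split; first exact: num_real.
by move=> y By x _ /=; apply: le_trans (gB x) (ltW By).
Qed.

Lemma mean_EFin (g : X -> R) :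
  bmeas g -> (\int[mu]_x (g x)%:E)%E = (mean g)%:E.
Proof.
move=> bg; rewrite /mean /Rintegral fineK//.
by apply: integrable_fin_num => //; exact: bmeas_integrable.
Qed.

Lemma bmeas_cst (r : R) : bmeas (fun=> r).
Proof. by split; [exact: measurable_cst | exists `|r|]. Qed.

Lemma bmeasD (f g : X -> R) : bmeas f -> bmeas g -> bmeas (fun x => f x + g x).
Proof.
move=> [mf [B fB]] [mg [C gC]]; split; first exact: measurable_funD.
exists (B + C) => x; apply: le_trans (ler_normD _ _) _; exact: lerD.
Qed.

Lemma bmeasM (f g : X -> R) : bmeas f -> bmeas g -> bmeas (fun x => f x * g x).
Proof.
move=> [mf [B fB]] [mg [C gC]]; split; first exact: measurable_funM.
by exists (B * C) => x; rewrite normrM; apply: ler_pM.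
Qed.

Lemma bmeasN (f : X -> R) : bmeas f -> bmeas (fun x => - f x).
Proof.
move=> [mf [B fB]]; split; first exact: measurableT_comp.
by exists B => x; rewrite normrN.
Qed.

Lemma bmeas_max0 (f : X -> R) : bmeas f -> bmeas (fun x => Num.max 0 (f x)).
Proof.
move=> [mf [B fB]]; split; first by apply: measurable_maxr.
exists B => x; rewrite /Num.max; case: ifP => // _.
by rewrite normr0; apply: le_trans (fB x).
Qed.

Lemma meanD (f g : X -> R) : bmeas f -> bmeas g ->
  mean (fun x => f x + g x) = mean f + mean g.
Proof. by move=> bf bg; apply: RintegralD => //; exact: bmeas_integrable. Qed.

Lemma meanZ (r : R) (f : X -> R) : bmeas f ->
  mean (fun x => r * f x) = r * mean f.
Proof. by move=> bf; apply: RintegralZl => //; exact: bmeas_integrable. Qed.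

Lemma mean_cst (r : R) : mean (fun=> r) = r.
Proof.
by rewrite /mean Rintegral_cst// [X in fine X]probability_setT mulr1.
Qed.

Lemma le_mean (f g : X -> R) : bmeas f -> bmeas g -> (forall x, f x <= g x) ->
  mean f <= mean g.
Proof.
move=> bf bg fg; apply: le_Rintegral => //; exact: bmeas_integrable.
Qed.

Lemma mean_sum (I : finType) (f : I -> X -> R) : (forall i, bmeas (f i)) ->
  bmeas (fun x => \sum_i f i x) /\
  mean (fun x => \sum_i f i x) = \sum_i mean (f i).
Proof.
move=> bf; rewrite -big_enum.
under [in bmeas _]eq_fun do rewrite -big_enum.
under [in mean _]eq_fun do rewrite -big_enum.
elim: (enum _) => /= [|i s [bs IH]].
  under [in bmeas _]eq_fun do rewrite big_nil.
  under [in mean _]eq_fun do rewrite big_nil.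
  by rewrite big_nil mean_cst; split => //; exact: bmeas_cst.
under [in bmeas _]eq_fun do rewrite big_cons.
under [in mean _]eq_fun do rewrite big_cons.
by rewrite big_cons meanD// IH; split => //; exact: bmeasD.
Qed.

Lemma mean_indic (S : set X) : measurable S ->
  bmeas (\1_S : X -> R) /\ mean (\1_S) = fine (mu S).
Proof.
move=> mS; split.
  split; first exact: measurable_indic.
  by exists 1 => x; rewrite indicE; case: (_ \in _); rewrite ?normr1 ?normr0.
by rewrite /mean /Rintegral integral_indic// setIT.
Qed.

Definition finite_rv (I : finType) (u : X -> I) :=
  forall i, measurable (u @^-1` [set i]).

Definition pr (I : finType) (u : X -> I) (i : I) : R :=
  fine (mu (u @^-1` [set i])).

Definition pair_rv (I J : finType) (u : X -> I) (v : X -> J) (x : X) := (u x, v x).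

Lemma finite_rv_pair (I J : finType) (u : X -> I) (v : X -> J) :
  finite_rv u -> finite_rv v -> finite_rv (pair_rv u v).
Proof.
move=> mu' mv [i j]; rewrite (_ : _ @^-1` _ = u @^-1` [set i] `&` v @^-1` [set j]).
  exact: measurableI.
by apply/seteqP; split => x /= [<- <-].
Qed.

Lemma finite_rv_comp (I J : finType) (u : X -> I) (g : I -> J) :
  finite_rv u -> finite_rv (g \o u).
Proof.
move=> fu j.
rewrite (_ : _ @^-1` _ = \bigcup_(i in [set i | g i = j]) (u @^-1` [set i])).
  by apply: fin_bigcup_measurable => // i _; exact: fu.
apply/seteqP; split => x /=; first by exists (u x).
by move=> [i /= gi ->].
Qed.

Lemma finite_rv_measurable (I : finType) (u : X -> I) (D : set I) :
  finite_rv u -> measurable (u @^-1` D).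
Proof.
move=> fu; rewrite (_ : _ @^-1` _ = \bigcup_(i in D) (u @^-1` [set i])).
  by apply: fin_bigcup_measurable => // i _; exact: fu.
apply/seteqP; split => x /=; first by exists (u x).
by move=> [i /= gi ->].
Qed.

Lemma finite_rv_ffun (n : nat) (I : finType) (u : 'I_n -> X -> I) :
  (forall i, finite_rv (u i)) -> finite_rv (fun x => [ffun i => u i x]).
Proof.
move=> fu w; rewrite (_ : _ @^-1` _ = \bigcap_(i in [set: 'I_n]) (u i @^-1` [set w i])).
  by apply: fin_bigcap_measurable => // i _; exact: fu.
apply/seteqP; split => x /=; first by move=> <- i _ /=; rewrite ffunE.
by move=> xw; apply/ffunP => i; rewrite ffunE; exact: xw.
Qed.

Lemma pr_ge0 (I : finType) (u : X -> I) i : 0 <= pr u i.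
Proof. exact: fine_ge0. Qed.

Lemma probability_fine (S : set X) : measurable S -> mu S = (fine (mu S))%:E.
Proof. by move=> mS; rewrite fineK// fin_num_measure. Qed.

Lemma fine_probability_le1 (S : set X) : measurable S -> fine (mu S) <= 1.
Proof.
by move=> mS; rewrite -lee_fin -probability_fine//; exact: probability_le1.
Qed.

Lemma le_fine_probability (S S' : set X) : measurable S -> measurable S' ->
  S `<=` S' -> fine (mu S) <= fine (mu S').
Proof.
move=> mS mS' SS'; rewrite -lee_fin -!probability_fine//.
by apply: le_measure => //; rewrite inE.
Qed.

Lemma fine_probabilityU2 (S S' : set X) : measurable S -> measurable S' ->
  fine (mu (S `|` S')) <= fine (mu S) + fine (mu S').
Proof.
move=> mS mS'; rewrite -lee_fin EFinD -!probability_fine//; last exact: measurableU.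
exact: measureU2.
Qed.

Lemma pr_le1 (I : finType) (u : X -> I) i : finite_rv u -> pr u i <= 1.
Proof. by move=> fu; apply: fine_probability_le1. Qed.

Lemma finite_rv_bmeas (I : finType) (u : X -> I) (h : I -> R) :
  finite_rv u -> bmeas (h \o u).
Proof.
move=> fu; split.
  by move=> _ Y mY; rewrite setTI comp_preimage; exact: finite_rv_measurable.
exists (\sum_i `|h i|) => x /=.
by rewrite (bigD1 (u x))//= lerDl sumr_ge0.
Qed.

Lemma mean_finite_rv (I : finType) (u : X -> I) (h : I -> R) :
  finite_rv u -> mean (h \o u) = \sum_i pr u i * h i.
Proof.
move=> fu.
have bi i : bmeas (fun x => h i * \1_(u @^-1` [set i]) x).
  by apply: bmeasM; [exact: bmeas_cst | exact: (mean_indic (fu i)).1].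
have := (mean_sum bi).2.
rewrite (_ : (fun x => _) = h \o u); last first.
  apply/funext => x /=; rewrite (bigD1 (u x))//= big1 => [|i iu].
    by rewrite indicE mem_set// mulr1 addr0.
  by rewrite indicE memNset ?mulr0// => /= ui; rewrite ui eqxx in iu.
move=> ->; apply: eq_bigr => i _.
by have [bI eI] := mean_indic (fu i); rewrite meanZ// eI mulrC.
Qed.

Lemma sum_pr (I : finType) (u : X -> I) : finite_rv u -> \sum_i pr u i = 1.
Proof.
move=> fu; rewrite -[RHS]mean_cst -[X in mean X]/((fun=> 1) \o u) mean_finite_rv//.
by apply: eq_bigr => i _; rewrite mulr1.
Qed.

Lemma pr_pred (I : finType) (u : X -> I) (D : {pred I}) : finite_rv u ->
  fine (mu (u @^-1` [set i | i \in D])) = \sum_(i in D) pr u i.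
Proof.
move=> fu; have mD := finite_rv_measurable [set i | i \in D] fu.
have [_ <-] := mean_indic mD.
rewrite (_ : \1_ _ = (fun i => (i \in D)%:R) \o u); last first.
  apply/funext => x /=; rewrite indicE; congr (_%:R); congr nat_of_bool.
  by apply/idP/idP; rewrite inE.
rewrite mean_finite_rv// [RHS]big_mkcond/=; apply: eq_bigr => i _.
by case: (i \in D); rewrite ?mulr1 ?mulr0.
Qed.

Lemma sum_pr_setI (I : finType) (u : X -> I) (B : set X) : finite_rv u -> measurable B ->
  \sum_i fine (mu (u @^-1` [set i] `&` B)) = fine (mu B).
Proof.
move=> fu mB; have [_ <-] := mean_indic mB.
have mI i : measurable (u @^-1` [set i] `&` B) by exact: measurableI.
rewrite (_ : \1_B = fun x => \sum_i (\1_(u @^-1` [set i] `&` B) x : R)).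
  rewrite (mean_sum (fun i => (mean_indic (mI i)).1)).2.
  by apply: eq_bigr => i _; rewrite (mean_indic (mI i)).2.
apply/funext => x; rewrite (bigD1 (u x))//= big1 ?addr0.
  by rewrite !indicE; congr (_%:R); congr nat_of_bool;
    apply/idP/idP; rewrite !inE; [split|case].
move=> i iu; rewrite indicE memNset// => -[/= ui _].
by rewrite ui eqxx in iu.
Qed.

Lemma pr_gt0_ex (I : finType) (u : X -> I) i : 0 < pr u i -> exists x, u x = i.
Proof.
move=> p0; apply: contrapT => /forallNP nx; move: p0; rewrite /pr.
rewrite (_ : _ @^-1` _ = set0) ?measure0 ?ltxx//.
by apply/seteqP; split => // x /= /nx.
Qed.

(** Null values are exempt because there [ln 0 = 0] can falsify the bounds to which this is
    applied. *)
Lemma le_mean_finite_rv (I : finType) (u : X -> I) (h1 h2 : I -> R) : finite_rv u ->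
  (forall i, 0 < pr u i -> h1 i <= h2 i) -> mean (h1 \o u) <= mean (h2 \o u).
Proof.
move=> fu hh; rewrite !mean_finite_rv//; apply: ler_sum => i _.
have := pr_ge0 u i; rewrite le_eqVlt => /predU1P[<-|p0]; first by rewrite !mul0r.
by rewrite ler_pM2l// hh.
Qed.

Definition info (I : finType) (u : X -> I) (x : X) : R := - ln (pr u (u x)).

Definition entropy (I : finType) (u : X -> I) : R := mean (info u).

Lemma bmeas_info (I : finType) (u : X -> I) : finite_rv u -> bmeas (info u).
Proof. by move=> fu; exact: (finite_rv_bmeas (fun i => - ln (pr u i)) fu). Qed.

Lemma entropyE (I : finType) (u : X -> I) : finite_rv u ->
  entropy u = - \sum_i pr u i * ln (pr u i).
Proof.
move=> fu; rewrite /entropy -[info u]/((fun i => - ln (pr u i)) \o u) mean_finite_rv//.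
by rewrite -sumrN; apply: eq_bigr => i _; rewrite mulrN.
Qed.

Lemma info_ge0 (I : finType) (u : X -> I) x : finite_rv u -> 0 <= info u x.
Proof. by move=> fu; rewrite oppr_ge0 ln_le0// pr_le1. Qed.

Lemma entropy_ge0 (I : finType) (u : X -> I) : finite_rv u -> 0 <= entropy u.
Proof. by move=> fu; apply: Rintegral_ge0 => x _; exact: info_ge0. Qed.

(** Each fibre of [v] lies in a fibre of [u], so off the null fibres of [v] the information of [u]
    is pointwise at most that of [v]. *)
Lemma entropy_le (I J : finType) (u : X -> I) (v : X -> J) : finite_rv u -> finite_rv v ->
  (forall x y, v x = v y -> u x = u y) -> entropy u <= entropy v.
Proof.
move=> fu fv vu; have fw := finite_rv_pair fu fv.
rewrite /entropy -[info u]/((fun i => - ln (pr u i.1)) \o pair_rv u v).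
rewrite -[info v]/((fun i => - ln (pr v i.2)) \o pair_rv u v).
apply: le_mean_finite_rv => // -[i j] p0 /=.
have [x [ux vx]] := pr_gt0_ex p0.
have vp : 0 < pr v j.
  apply: lt_le_trans p0 _; apply: le_fine_probability; [exact: fw|exact: fv|].
  by move=> y /= [].
have vlu : pr v j <= pr u i.
  apply: le_fine_probability; [exact: fv|exact: fu|].
  by move=> y /= vy; rewrite -ux; apply: vu; rewrite vy.
by rewrite lerN2 ler_ln// posrE (lt_le_trans vp).
Qed.

(** From [ln y <= y - 1] at [y = s i / S / pr u i]. The weights [s] act as a code with lengths at
    most [c] and total mass at most [S]; the comparisons of a pair with its components below are
    choices of [s]. *)
Lemma gibbs (I : finType) (u : X -> I) (s c : I -> R) (S : R) : finite_rv u -> 0 < S ->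
  (forall i, 0 <= s i) -> \sum_i s i <= S ->
  (forall i, 0 < pr u i -> 0 < s i /\ - ln (s i) <= c i) ->
  entropy u <= ln S + mean (c \o u).
Proof.
move=> fu S0 s0 sS sc; rewrite entropyE// mean_finite_rv//.
have term i : - (pr u i * ln (pr u i)) <=
    s i / S - pr u i + pr u i * ln S + pr u i * c i.
  have := pr_ge0 u i; rewrite le_eqVlt => /predU1P[<-|p0].
    by rewrite !mul0r oppr0 !addr0 divr_ge0// ltW.
  have [si0 sic] := sc _ p0.
  have ratio0 : 0 < s i / S / pr u i by rewrite !divr_gt0.
  have : ln (s i / S / pr u i) <= s i / S / pr u i - 1.
    rewrite -{1}(subrK 1 (s i / S / pr u i)) [_ + 1]addrC.
    by apply: le_ln1Dx; rewrite ltrBDr addNr.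
  rewrite !ln_div ?posrE ?divr_gt0// => lnle.
  have := ler_wpM2l (ltW p0) lnle; rewrite [X in _ <= X]mulrBr mulr1.
  rewrite [pr u i * (_ / _)]mulrC mulfVK ?gt_eqF// => {}lnle.
  have := ler_wpM2l (ltW p0) sic; nra.
rewrite -sumrN; apply: le_trans (ler_sum _ (fun i _ => term i)) _.
rewrite !big_split/= sumrN sum_pr// -!mulr_suml sum_pr// mul1r lerD2r.
by rewrite gerDr subr_le0 ler_pdivrMr// mul1r.
Qed.

Lemma entropy_pair_le (I J : finType) (u : X -> I) (v : X -> J) :
  finite_rv u -> finite_rv v -> entropy (pair_rv u v) <= entropy u + entropy v.
Proof.
move=> fu fv; have fw := finite_rv_pair fu fv.
pose c (ij : I * J) := - ln (pr u ij.1) - ln (pr v ij.2).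
apply: le_trans (@gibbs _ _ (fun ij => pr u ij.1 * pr v ij.2) c 1 fw ltr01 _ _ _) _.
- by move=> i; rewrite mulr_ge0// pr_ge0.
- rewrite -(pair_bigA _ (fun i j => pr u i * pr v j))/=.
  under eq_bigr do rewrite -mulr_sumr sum_pr// mulr1.
  by rewrite sum_pr.
- move=> [i j] p0 /=.
  have pu : 0 < pr u i.
    by apply: lt_le_trans p0 _; apply: le_fine_probability => // y [].
  have pv : 0 < pr v j.
    by apply: lt_le_trans p0 _; apply: le_fine_probability => // y [].
  by rewrite mulr_gt0// lnM// /c opprD.
- rewrite ln1 add0r /entropy -meanD; [|exact: bmeas_info..].
  by apply: le_mean => //; [exact: finite_rv_bmeas|apply: bmeasD; exact: bmeas_info].
Qed.

(* [kappa] is a transition kernel; coding [u] given [v] letter by letter with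
   [kappa] costs [c] per letter. *)
Lemma entropy_kernel (n : nat) (I J : finType) (u : X -> {ffun 'I_n -> I})
    (v : X -> {ffun 'I_n -> J}) (kappa c : I -> J -> R) :
  finite_rv u -> finite_rv v -> (forall i j, 0 < kappa i j) ->
  (forall j, \sum_i kappa i j <= 1) ->
  (forall i j, - ln (kappa i j) <= c i j) ->
  entropy u <= entropy v + mean (fun x => \sum_t c (u x t) (v x t)).
Proof.
move=> fu fv k0 k1 kc; have fw := finite_rv_pair fu fv.
apply: le_trans (entropy_le fu fw _) _; first by move=> x y [].
pose s (ab : {ffun 'I_n -> I} * {ffun 'I_n -> J}) :=
  pr v ab.2 * \prod_t kappa (ab.1 t) (ab.2 t).
pose c' (ab : {ffun 'I_n -> I} * {ffun 'I_n -> J}) :=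
  - ln (pr v ab.2) + \sum_t c (ab.1 t) (ab.2 t).
have prod0 (ab : {ffun 'I_n -> I} * {ffun 'I_n -> J}) :
    0 < \prod_t kappa (ab.1 t) (ab.2 t) by apply: prodr_gt0.
apply: le_trans (@gibbs _ _ s c' 1 fw ltr01 _ _ _) _.
- by move=> i; rewrite mulr_ge0 ?pr_ge0// ltW.
- rewrite -(pair_bigA _ (fun (a : {ffun 'I_n -> I}) (b : {ffun 'I_n -> J}) =>
    pr v b * \prod_t kappa (a t) (b t)))/=.
  rewrite exchange_big/= -[leRHS](sum_pr fv); apply: ler_sum => b _.
  rewrite -mulr_sumr ler_piMr ?pr_ge0//.
  (* Summed over all words, the product factors into one sum of [kappa] per letter. *)
  rewrite -(bigA_distr_bigA (fun t i => kappa i (b t)))/=.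
  by apply: prodr_ile1 => t _; rewrite k1 sumr_ge0// => i _; rewrite ltW.
- move=> [a b] p0.
  have pv : 0 < pr v b.
    by apply: lt_le_trans p0 _; apply: le_fine_probability => // y [].
  split; first by rewrite mulr_gt0.
  rewrite /s /c'/= lnM ?posrE//; last exact: (prod0 (a, b)).
  rewrite opprD lerD2l.
  have lnprod (r : seq 'I_n) : ln (\prod_(t <- r) kappa (a t) (b t)) =
      \sum_(t <- r) ln (kappa (a t) (b t)).
    elim: r => [|t r IH]; first by rewrite !big_nil ln1.
    by rewrite !big_cons lnM ?posrE ?IH// prodr_gt0.
  by rewrite lnprod -sumrN; apply: ler_sum.
- have bc : bmeas (fun x => \sum_t c (u x t) (v x t)).
    exact: (finite_rv_bmeas (fun ab : {ffun 'I_n -> I} * {ffun 'I_n -> J} =>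
      \sum_t c (ab.1 t) (ab.2 t)) fw).
  rewrite ln1 add0r /entropy -meanD//; last exact: bmeas_info.
Qed.

(* The weight [q(b) / t(b, w)] has total mass at most 2: one unit for the words
   in [D], listed by [t b], and one for the other words. *)
Lemma entropy_count (I J : finType) (w : X -> I) (b : X -> J) (D : {set I})
    (t : J -> {set I}) : finite_rv w -> finite_rv b ->
  (forall x, w x \in D -> w x \in t (b x)) ->
  entropy w <= entropy b + mean (fun x => ln #|t (b x)|%:R)
    + fine (mu (w @^-1` [set i | i \notin D])) * ln #|I|%:R + ln 2.
Proof.
move=> fw fb wt; have fwb := finite_rv_pair fw fb.
apply: le_trans (entropy_le fw fwb _) _; first by move=> x y [].
pose s (ij : I * J) := pr b ij.2 *
  (if ij.1 \in D then (if ij.1 \in t ij.2 then #|t ij.2|%:R^-1 else 0)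
   else #|I|%:R^-1).
pose c (ij : I * J) := - ln (pr b ij.2) +
  (if ij.1 \in D then ln #|t ij.2|%:R else ln #|I|%:R).
apply: le_trans (@gibbs _ _ s c 2 fwb _ _ _ _) _ => //.
- by move=> i; rewrite mulr_ge0 ?pr_ge0//; case: ifP => // _; case: ifP.
- have -> : (2 : R) = \sum_j pr b j * (1 + 1) by rewrite -mulr_suml sum_pr// mul1r.
  rewrite -(pair_bigA _ (fun i j => s (i, j)))/= exchange_big/=.
  apply: ler_sum => j _; rewrite /s/= -mulr_sumr ler_wpM2l ?pr_ge0//.
  apply: (@le_trans _ _ (\sum_(i in t j) (#|t j|%:R^-1 : R) + \sum_(i : I) #|I|%:R^-1)).
    rewrite (big_mkcond (mem (t j)))/= -big_split/=; apply: ler_sum => i _.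
    case: ifP => // _; case: ifP => // _; rewrite ?add0r ?lerDl ?lerDr ?addr0//.
  have inv_le1 (k : nat) : (k%:R^-1 : R) *+ k <= 1.
    by case: k => [|k]; rewrite ?mulr0n// -[leLHS]mulr_natr mulVf// pnatr_eq0.
  by rewrite !sumr_const; apply: lerD; exact: inv_le1.
- move=> [i j] p0.
  have pv : 0 < pr b j.
    by apply: lt_le_trans p0 _; apply: le_fine_probability => // y [].
  have [x [wx bx]] := pr_gt0_ex p0.
  have I0 : (0 < #|I|)%N by apply/card_gt0P; exists i.
  rewrite /s /c/=; case: ifPn => iD.
    have it : i \in t j by rewrite -wx -bx wt// wx.
    have t0 : (0 < #|t j|)%N by apply/card_gt0P; exists i.
    rewrite it mulr_gt0 ?invr_gt0 ?ltr0n//; split => //.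
    by rewrite lnM ?posrE ?invr_gt0 ?ltr0n// lnV ?posrE ?ltr0n// opprD opprK.
  rewrite mulr_gt0 ?invr_gt0 ?ltr0n//; split => //.
  by rewrite lnM ?posrE ?invr_gt0 ?ltr0n// lnV ?posrE ?ltr0n// opprD opprK.
- have mD : measurable (w @^-1` [set i | i \notin D]) by exact: finite_rv_measurable.
  have [bI eI] := mean_indic mD.
  have bt : bmeas (fun x => ln (#|t (b x)|%:R : R)).
    exact: (finite_rv_bmeas (fun j => ln #|t j|%:R) fb).
  rewrite addrC lerD2r -eI [_ * ln _]mulrC -meanZ// /entropy.
  have bi := bmeas_info fb.
  have bc := finite_rv_bmeas c fwb.
  have bII : bmeas (fun x => ln #|I|%:R * \1_(w @^-1` [set i | i \notin D]) x).
    by apply: bmeasM => //; exact: bmeas_cst.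
  rewrite -!meanD//; last exact: bmeasD.
  apply: le_mean => //; first by apply: bmeasD => //; exact: bmeasD.
  move=> x; rewrite /c /= /info -addrA lerD2l indicE.
  have [wD|wD] := boolP (w x \in D).
    by rewrite lerDl mulr_ge0// ln_ge0// ler1n; apply/card_gt0P; exists (w x).
  rewrite mem_set// mulr1 lerDr.
  have [->|t0] := posnP #|t (b x)|; first by rewrite ln0.
  by rewrite ln_ge0// ler1n.
Qed.

End FiniteVariables.

(** * The ergodic theorem *)

Section Ergodic.
Context (d : measure_display) (X : measurableType d) (R : realType).
Context (mu : probability X R) (T : X -> X).
Hypothesis mT : measurable_fun setT T.
Hypothesis invT : forall S : set X, measurable S -> mu (T @^-1` S) = mu S.

Lemma measurable_iter k (S : set X) : measurable S -> measurable (iter k T @^-1` S).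
Proof.
move=> mS; elim: k => [//|k IH].
rewrite (_ : iter k.+1 T @^-1` _ = T @^-1` (iter k T @^-1` S)); last first.
  by apply/seteqP; split => x /=; rewrite -iterS iterSr.
by rewrite -[X in measurable X]setTI; apply: mT.
Qed.

Lemma finite_rv_iter k (I : finType) (u : X -> I) : finite_rv u -> finite_rv (u \o iter k T).
Proof. by move=> fu i; rewrite comp_preimage; exact: measurable_iter. Qed.

Lemma bmeas_comp (g : X -> R) : bmeas g -> bmeas (g \o T).
Proof.
move=> [mg [B gB]]; split; first exact: measurableT_comp.
by exists B => x /=.
Qed.

Lemma mean_comp (g : X -> R) : bmeas g -> mean mu (g \o T) = mean mu g.
Proof.
move=> bg; apply: EFin_inj; rewrite -(mean_EFin _ (bmeas_comp bg)) -(mean_EFin mu bg).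
rewrite -[LHS](@integral_pushforward _ _ _ _ _ T mT mu setT (EFin \o g))//.
- by apply: eq_measure_integral => A mA _; exact: invT.
- by apply/measurable_EFinP; exact: bg.1.
- by rewrite preimage_setT; exact: (bmeas_integrable mu (bmeas_comp bg)).
Qed.

(** The maximum of the Birkhoff sums of lengths 0 to [n], written so that the first term splits
    off. *)
Fixpoint maxsum (f : X -> R) (n : nat) (x : X) : R :=
  if n is m.+1 then Num.max 0 (f x + maxsum f m (T x)) else 0.

Lemma maxsum_ge0 f n x : 0 <= maxsum f n x.
Proof. by case: n => //= n; rewrite le_max lexx. Qed.

Lemma maxsum_leS f n x : maxsum f n x <= maxsum f n.+1 x.
Proof.
elim: n x => [|n IH] x; first exact: maxsum_ge0.
rewrite [leLHS]/= [leRHS]/= ge_max le_max lexx/= le_max; apply/orP; right.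
by rewrite lerD2l; exact: IH.
Qed.

Lemma maxsum_le f n m x : (n <= m)%N -> maxsum f n x <= maxsum f m x.
Proof.
move=> /subnK <-; elim: (m - n)%N => // k IH; rewrite addSn.
by apply: le_trans IH _; exact: maxsum_leS.
Qed.

Lemma bmeas_maxsum f n : bmeas f -> bmeas (maxsum f n).
Proof.
move=> bf; elim: n => [|n IH]; first exact: bmeas_cst.
by apply: bmeas_max0; apply: bmeasD => //; exact: bmeas_comp.
Qed.

Lemma birkhoff_sum_le f n x : \sum_(i < n) f (iter i T x) <= maxsum f n x.
Proof.
elim: n x => [|n IH] x; first by rewrite big_ord0.
rewrite big_ord_recl /= le_max; apply/orP; right; rewrite lerD2l.
apply: le_trans (IH (T x)); under eq_bigr do rewrite /= -iterS iterSr.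
exact: lexx.
Qed.

Let Epos f n := [set x | 0 < maxsum f n x].

Lemma measurable_maxsum_gt f n (r : R) : bmeas f -> measurable [set x | r < maxsum f n x].
Proof.
move=> bf; have [mf _] := bmeas_maxsum n bf.
rewrite (_ : [set _ | _] = maxsum f n @^-1` `]r, +oo[).
  by rewrite -[X in measurable X]setTI; apply: mf.
by apply/seteqP; split => x /=; rewrite in_itv/= andbT.
Qed.

(* Garsia's proof of the maximal ergodic theorem. *)
Lemma maximal_ergodic f n : bmeas f ->
  0 <= mean mu (fun x => f x * \1_(Epos f n.+1) x).
Proof.
move=> bf; have mE : measurable (Epos f n.+1) by exact: measurable_maxsum_gt.
have bM := bmeas_maxsum n.+1 bf.
have bMT := bmeas_comp bM.
(* By invariance 0 is the mean of [M - M o T] with [M = maxsum f n.+1]; this difference is at most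
   [f] where [M > 0] and at most 0 elsewhere. *)
have -> : 0 = mean mu (fun x => maxsum f n.+1 x + - (maxsum f n.+1 \o T) x).
  rewrite meanD//; last exact: bmeasN.
  rewrite (_ : (fun x => - _) = (fun x => -1 * (maxsum f n.+1 \o T) x)).
    by rewrite meanZ// mean_comp// mulN1r subrr.
  by apply/funext => x; rewrite mulN1r.
apply: le_mean.
- by apply: bmeasD => //; exact: bmeasN.
- by apply: bmeasM => //; have [] := mean_indic mu mE.
move=> x; rewrite [(_ \o _) x]/(maxsum f n.+1 (T x)) indicE.
have [xE|xE] := pselect (Epos f n.+1 x).
  rewrite mem_set// mulr1 lerBlDr.
  move: xE; rewrite /Epos/= lt_max ltxx/= => xE.
  rewrite (max_r (ltW xE)) lerD2l; exact: maxsum_leS.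
rewrite memNset// mulr0 subr_le0.
move/negP: xE; rewrite -leNgt => xE.
exact: le_trans xE (maxsum_ge0 f n.+1 (T x)).
Qed.

Hypothesis ergT : forall S : set X, measurable S -> T @^-1` S = S ->
  mu S = 0%E \/ mu S = 1%E.

Let Bset f (K : nat) := \bigcup_N [set x | K%:R < maxsum f N x].

Let mB f K : bmeas f -> measurable (Bset f K).
Proof. by move=> bf; apply: bigcupT_measurable => N; exact: measurable_maxsum_gt. Qed.

(** The set where the Birkhoff sums are unbounded above is invariant, since passing from [x] to
    [T x] changes them by one bounded term. Were it of full measure, the sets of the maximal
    inequality would fill the space and force [mean mu f >= 0]. *)
Lemma unbounded_maxsum_null f : bmeas f -> mean mu f < 0 ->
  mu (\bigcap_K Bset f K) = 0%E.
Proof.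
move=> bf f0; have [_ [B fB]] := bf.
have mU : measurable (\bigcap_K Bset f K) by apply: bigcapT_measurable => K; exact: mB.
have [] // := ergT mU.
  apply/seteqP; split => x Ux K _.
  (* Raising the level by [k], which exceeds the bound [B] of [f], pays for the term [f x]. *)
  - pose k := (Num.truncn `|B|).+1.
    have [N _ /= hN] := Ux (K + k)%N I; exists N.+1 => //=.
    rewrite lt_max; apply/orP; right.
    have := fB x; rewrite ler_norml => /andP[fx _].
    have : B < k%:R by apply: le_lt_trans (ler_norm B) _; apply: truncnS_gt.
    move: hN; rewrite natrD; lra.
  - pose k := (Num.truncn `|B|).+1.
    have [[|N] _ /= hN] := Ux (K + k)%N I.
      by have := lt_le_trans hN (ler0n R 0); rewrite ltrn0.
    exists N => //=.
    have := fB x; rewrite ler_norml => /andP[_ fx].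
    have kB : B < k%:R by apply: le_lt_trans (ler_norm B) _; apply: truncnS_gt.
    move: hN; rewrite natrD lt_max => /orP[|]; last by lra.
    by have := ler0n R K; have := ler0n R k; lra.
move=> U1; exfalso.
have mE n : measurable (Epos f n) by exact: measurable_maxsum_gt.
have cE : mu (Epos f n.+1) @[n --> \oo] --> mu (\bigcup_n Epos f n.+1).
  apply: nondecreasing_cvg_mu => //.
    by apply: bigcupT_measurable => n; exact: mE.
  move=> n m nm; apply/subsetPset => x /= /lt_le_trans; apply.
  exact: maxsum_le.
have E1 : mu (\bigcup_n Epos f n.+1) = 1%E.
  apply/eqP; rewrite eq_le probability_le1/=; last first.
    by apply: bigcupT_measurable => n; exact: mE.
  rewrite -U1; apply: le_measure; rewrite ?inE//.
    by apply: bigcupT_measurable => n; exact: mE.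
  move=> x /(_ 0%N I) [N _ /= hN]; exists N => //=.
  by apply: lt_le_trans hN (maxsum_leS _ _ _).
rewrite E1 in cE.
have cfE : fine (mu (Epos f n.+1)) @[n --> \oo] --> (1 : R) by exact: fine_cvg cE.
have B0 : 0 <= B.
  have [x _] : exists x : X, True.
    by exists point.
  by apply: le_trans (fB x).
(* Once the complement of the positivity set has less mass than this, [B] times that mass is below
   [- mean mu f], against the maximal inequality; [B + 1] keeps the divisor positive. *)
have : - mean mu f / (B + 1) > 0 by apply: divr_gt0; rewrite ?oppr_gt0//; lra.
move=> e0.
have /cvgrPdist_lt/(_ _ e0) [N _ /(_ N (leqnn N))] := cfE.
rewrite /= => close.
have mEN := mE N.+1; have [bI eI] := mean_indic mu mEN.
have : mean mu (fun x => f x * \1_(Epos f N.+1) x) <=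
       mean mu (fun x => f x + B * (1 + - \1_(Epos f N.+1) x)).
  apply: le_mean.
  - exact: bmeasM.
  - apply: bmeasD => //; apply: bmeasM; first exact: bmeas_cst.
    by apply: bmeasD; [exact: bmeas_cst|exact: bmeasN].
  move=> x; rewrite indicE; have := fB x; rewrite ler_norml => /andP[fx _].
  by case: (x \in _) => /=; rewrite ?mulr1 ?mulr0; lra.
have -> : (fun x => f x + B * (1 + - \1_(Epos f N.+1) x)) =
          (fun x => (f x + B) + (- B) * \1_(Epos f N.+1) x).
  by apply/funext => x; ring.
have bfB : bmeas (fun x => f x + B) by apply: bmeasD => //; exact: bmeas_cst.
have bBI : bmeas (fun x => - B * \1_(Epos f N.+1) x).
  by apply: bmeasM => //; exact: bmeas_cst.
rewrite meanD// meanD//; last exact: bmeas_cst.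
rewrite meanZ// eI mean_cst.
have := maximal_ergodic N bf.
move: close; set m := fine _ => close h1 h2.
have m1 : m <= 1 by apply: fine_probability_le1.
move: close; rewrite ger0_norm ?subr_ge0// ltr_pdivlMr; last by lra.
nra.
Qed.

(** Continuity from above along the levels [K], whose intersection is null. One [K] serves all [n]:
    this boundedness in probability is the form in which the ergodic theorem enters. *)
Lemma birkhoff_upper f : bmeas f -> mean mu f < 0 -> forall eps : R, 0 < eps ->
  exists K : nat, forall n (S : set X), measurable S ->
    S `<=` [set x | K%:R < \sum_(i < n) f (iter i T x)] ->
    fine (mu S) <= eps.
Proof.
move=> bf f0 eps e0.
have cB : mu (Bset f K) @[K --> \oo] --> mu (\bigcap_K Bset f K).
  apply: nonincreasing_cvg_mu => //.
  - exact: le_lt_trans (probability_le1 mu (mB 0 bf)) (ltry _).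
  - by move=> K; exact: mB.
  - by apply: bigcapT_measurable => K; exact: mB.
  - move=> K K' KK'; apply/subsetPset => x [N _ /= hN]; exists N => //=.
    by apply: le_lt_trans hN; rewrite ler_nat.
rewrite unbounded_maxsum_null// in cB.
have cfB : fine (mu (Bset f K)) @[K --> \oo] --> (0 : R) by exact: fine_cvg cB.
have /cvgrPdist_lt/(_ _ e0) [K _ /(_ K (leqnn K))] := cfB.
rewrite /= sub0r normrN ger0_norm ?fine_ge0// => muK.
exists K => n S mS SK; apply: le_trans (ltW muK).
apply: le_fine_probability => //; first exact: mB.
move=> x /SK /= Kx; exists n => //=; apply: lt_le_trans Kx _.
exact: birkhoff_sum_le.
Qed.

End Ergodic.

(** * Entropy rate and information of words *)

Section Words.
Context (R : realType) (A : finType) (a0 : A).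
Local Notation X := (@Conf A a0).
Local Notation T := (@sshift A a0).

Lemma finite_rv_coord (j : int) : finite_rv (fun x : X => x j).
Proof.
move=> a; apply: sub_sigma_algebra; exists j, 1%N, (fun=> a).
apply/seteqP; split => x /=.
  by move=> xj k; rewrite ord1 addr0.
by move=> /(_ ord0); rewrite addr0.
Qed.

Definition word (lo : int) (n : nat) (x : X) : n.-tuple A :=
  [tuple x (lo + (i : nat)%:Z) | i < n].

Lemma finite_rv_word lo n : finite_rv (word lo n).
Proof.
rewrite (_ : word lo n = (fun w : {ffun 'I_n -> A} => [tuple w i | i < n]) \o
   (fun x : X => [ffun i : 'I_n => x (lo + (i : nat)%:Z)])).
  by apply: finite_rv_comp; apply: finite_rv_ffun => i; exact: finite_rv_coord.
apply/funext => x /=; apply: eq_from_tnth => i.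
by rewrite !tnth_mktuple ffunE.
Qed.

Lemma word_eq lo n x y : word lo n x = word lo n y <->
  forall k : nat, (k < n)%N -> x (lo + k%:Z) = y (lo + k%:Z).
Proof.
split=> [/(congr1 (@tnth _ _)) e k kn|e].
  by have := congr1 (fun h => h (Ordinal kn)) e; rewrite !tnth_mktuple.
by apply: eq_from_tnth => i; rewrite !tnth_mktuple e.
Qed.

Lemma iter_sshift k (x : X) j : iter k T x j = x (j + k%:Z).
Proof.
elim: k x j => [|k IH] x j; first by rewrite addr0.
by rewrite iterS /sshift IH; congr x; lia.
Qed.

Lemma word_shift lo n k (x : X) : word lo n (iter k T x) = word (lo + k%:Z) n x.
Proof.
apply: eq_from_tnth => i; rewrite !tnth_mktuple iter_sshift; congr x; lia.
Qed.

Lemma measurable_sshift : measurable_fun setT T.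
Proof.
apply: (@measurability _ _ _ _ setT T (@cylinders A a0)) => //.
move=> _ [_ [lo [L [w ->]] <-]]; rewrite setTI.
apply: sub_sigma_algebra; exists (lo + 1), L, w.
apply/seteqP; split => x /= h k; rewrite -(h k) /sshift; congr x; lia.
Qed.

Context (mu : probability X R).
Hypothesis invT : mu_invariant mu T.

Lemma invT_iter k (S : set X) : measurable S -> mu (iter k T @^-1` S) = mu S.
Proof.
elim: k S => [|k IH] S mS //.
rewrite (_ : _ @^-1` _ = iter k T @^-1` (T @^-1` S)).
  rewrite IH; first exact: invT.
  by rewrite -[X in measurable X]setTI; apply: measurable_sshift.
by apply/seteqP; split => x.
Qed.

Lemma pr_iter k (I : finType) (u : X -> I) i : finite_rv u ->
  pr mu (u \o iter k T) i = pr mu u i.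
Proof. by move=> fu; rewrite /pr comp_preimage invT_iter. Qed.

Lemma pr_word lo n t : pr mu (word lo n) t = pr mu (word 0 n) t.
Proof.
have shift k l : pr mu (word (l + k%:Z) n) t = pr mu (word l n) t.
  rewrite -(pr_iter k t (@finite_rv_word l n)); congr (pr mu _ t).
  by apply/funext => x /=; rewrite word_shift.
case: lo => [k|k]; first by rewrite -(shift k 0) add0r.
(* [Negz k] is [-(k + 1)], so [k.+1] forward shifts bring the window to 0. *)
rewrite -(shift k.+1 (Negz k)); congr (pr mu (word _ n) t); lia.
Qed.

Definition word_entropy n := entropy mu (word 0 n).

Lemma entropy_word lo n : entropy mu (word lo n) = word_entropy n.
Proof.
rewrite /word_entropy !entropyE; [|exact: finite_rv_word..].
by congr (- _); apply: eq_bigr => t _; rewrite pr_word.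
Qed.

Lemma word_entropy_ge0 n : 0 <= word_entropy n. Proof. by apply: entropy_ge0; exact: finite_rv_word. Qed.

Lemma word_entropy_subadd m n : word_entropy (m + n) <= word_entropy m + word_entropy n.
Proof.
rewrite -[word_entropy n](entropy_word m%:Z).
apply: le_trans (entropy_pair_le mu (@finite_rv_word _ _) (@finite_rv_word _ _)).
apply: entropy_le; [exact: finite_rv_word|by apply: finite_rv_pair; exact: finite_rv_word|].
move=> x y xy; apply/word_eq => k kmn.
have /word_eq xy1 := congr1 fst xy; have /word_eq xy2 := congr1 snd xy.
have [km|mk] := ltnP k m; first exact: xy1.
have := xy2 (k - m)%N; rewrite (_ : 0 + k%:Z = m%:Z + (k - m)%N%:Z); last by lia.
by apply; lia.
Qed.

(* The infimum is taken over lengths [n.+1], avoiding [word_entropy 0 / 0]. *)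
Definition rate := inf [set word_entropy n.+1 / n.+1%:R | n in [set: nat]].

Lemma rate_le n : rate * n%:R <= word_entropy n.
Proof.
case: n => [|n]; first by rewrite mulr0 word_entropy_ge0.
rewrite -ler_pdivlMr ?ltr0n//; apply: ge_inf; last by exists n.
by exists 0 => _ [m _ <-]; rewrite divr_ge0// word_entropy_ge0.
Qed.

Lemma rate_ge0 : 0 <= rate.
Proof.
apply: lb_le_inf; first by exists (word_entropy 1 / 1), 0%N.
by move=> _ [m _ <-]; rewrite divr_ge0// word_entropy_ge0.
Qed.

Lemma rate_lt (eps : R) : 0 < eps -> exists n, word_entropy n.+1 < n.+1%:R * (rate + eps).
Proof.
move=> e0; have : has_inf [set word_entropy n.+1 / n.+1%:R | n in [set: nat]].
  split; first by exists (word_entropy 1 / 1), 0%N.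
  by exists 0 => _ [m _ <-]; rewrite divr_ge0// word_entropy_ge0.
move=> /(inf_adherent e0)[_ [n _ <-]]; rewrite ltr_pdivrMr ?ltr0n// mulrC.
by exists n.
Qed.

Lemma word_entropy_mul q m r : word_entropy (q * m + r) <= q%:R * word_entropy m + r%:R * word_entropy 1.
Proof.
elim: q => [|q IH].
  rewrite mul0n add0n mul0r add0r; elim: r => [|r IH].
    apply: (@le_trans _ _ (ln 1)); last by rewrite ln1 mul0r.
    rewrite /word_entropy entropyE; last exact: finite_rv_word.
    rewrite big1 ?oppr0 ?ln1// => t _.
    rewrite /pr (_ : _ @^-1` _ = setT) ?[X in fine X]probability_setT ?ln1 ?mulr0//.
    by apply/seteqP; split => // x _ /=; rewrite (tuple0 t); exact: tuple0.
  rewrite -addn1; apply: le_trans (word_entropy_subadd r 1) _.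
  by rewrite natrD mulrDl mul1r lerD2r.
rewrite mulSn -addnA; apply: le_trans (word_entropy_subadd _ _) _.
by rewrite -natr1 mulrDl mul1r; lra.
Qed.

Lemma fekete (eps : R) : 0 < eps ->
  exists N, forall n, (N <= n)%N -> word_entropy n <= n%:R * (rate + eps).
Proof.
move=> e0; have e20 : 0 < eps / 2 by rewrite divr_gt0.
have [m hm] := rate_lt e20.
(* Bounds the cost of the remainder of [n] modulo the block length [m.+1], uniformly in [n]. *)
pose C := m.+1%:R * word_entropy 1.
exists (Num.truncn (C / (eps / 2))).+1 => n Nn.
have Cn : C <= n%:R * (eps / 2).
  rewrite -ler_pdivrMr//; apply: le_trans (ltW (truncnS_gt _)) _.
  by rewrite ler_nat.
rewrite {1}(divn_eq n m.+1); apply: le_trans (word_entropy_mul _ _ _) _.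
have rC : (n %% m.+1)%:R * word_entropy 1 <= C.
  by rewrite ler_wpM2r ?word_entropy_ge0// ler_nat ltnW// ltn_pmod.
have qm : (n %/ m.+1)%:R * word_entropy m.+1 <= n%:R * (rate + eps / 2).
  apply: le_trans (ler_wpM2l (ler0n _ _) (ltW hm)) _.
  rewrite mulrA -natrM ler_wpM2r//; last by rewrite ler_nat leq_trunc_div.
  by rewrite addr_ge0 ?rate_ge0 ?ltW.
by nra.
Qed.

(** If every increment were at least [rate + eps], so would be every average
    [word_entropy n.+1 / n.+1], against the infimum. The [k] found serves as the order of the Markov
    approximation. *)
Lemma small_increment (eps : R) : 0 < eps -> exists k, word_entropy k.+1 - word_entropy k < rate + eps.
Proof.
move=> e0; apply: contrapT => /forallNP h.
have hk k : word_entropy k + (rate + eps) <= word_entropy k.+1.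
  by have /negP := h k; rewrite -leNgt; lra.
have [n] := rate_lt e0; apply/negP; rewrite -leNgt.
elim: n.+1 => [|m IH]; first by rewrite mul0r word_entropy_ge0.
by rewrite -natr1 mulrDl mul1r; have := hk m; lra.
Qed.


(** Plain sequences instead of tuples, because [markov_prob] recurses on words and truncates them
    with [take]. *)
Definition wseq (n : nat) (x : X) : seq A := mkseq (fun i => x i%:Z) n.

Lemma val_word n x : tval (word 0 n x) = wseq n x.
Proof.
apply: (@eq_from_nth _ a0); rewrite size_tuple ?size_mkseq// => i ni.
by rewrite nth_mkseq// -(tnth_nth a0 _ (Ordinal ni)) tnth_mktuple add0r.
Qed.

Lemma wseqS n x : wseq n.+1 x = x 0 :: wseq n (T x).
Proof.
rewrite /wseq /mkseq /= -[1%N]/(1 + 0)%N iotaDl -map_comp; congr (_ :: _).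
by apply: eq_map => i /=; rewrite /sshift; congr x; lia.
Qed.

Lemma take_wseq k n x : (k <= n)%N -> take k (wseq n x) = wseq k x.
Proof. by move=> kn; rewrite /wseq /mkseq -map_take take_iota (minn_idPl kn). Qed.

Definition word_prob (s : seq A) : R := fine (mu [set x | wseq (size s) x = s]).

Lemma pr_wordE n (t : n.-tuple A) : pr mu (word 0 n) t = word_prob t.
Proof.
rewrite /pr /word_prob; congr (fine (mu _)); apply/seteqP; split => x /=.
  by rewrite -val_word size_tuple => ->.
by rewrite size_tuple -val_word => /val_inj.
Qed.

Lemma measurable_wseq s : measurable [set x | wseq (size s) x = s].
Proof.
rewrite (_ : [set _ | _] = word 0 (size s) @^-1` [set in_tuple s]).
  exact: finite_rv_word.
apply/seteqP; split => x /=; last by move=> xs; rewrite -val_word xs.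
by rewrite -val_word => xs; apply: val_inj.
Qed.

Lemma word_prob_ge0 s : 0 <= word_prob s. Proof. exact: fine_ge0. Qed.

(** The sum frees the letter at 0 and leaves [s] at the positions from 1 on; invariance moves it
    back to 0. *)
Lemma sum_word_prob_cons s : \sum_a word_prob (a :: s) = word_prob s.
Proof.
have mS : measurable (T @^-1` [set x | wseq (size s) x = s]).
  rewrite -[X in measurable X]setTI; apply: measurable_sshift => //.
  exact: measurable_wseq.
rewrite /word_prob -(invT (measurable_wseq s)).
rewrite -(sum_pr_setI mu (finite_rv_coord 0) mS); apply: eq_bigr => a _.
congr (fine (mu _)); apply/seteqP; split => x /=; rewrite wseqS.
  by move=> [-> ->].
by move=> [-> ->].
Qed.

(** * Markov approximation of the law of words *)

Section Markov.
Variable k : nat.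

(* The first letter of [s] is drawn given the next [k] ones; the last [k] letters get
   weight 1, whence the total mass [#|A| ^ k]. *)
Fixpoint markov_prob (s : seq A) : R :=
  if s is a :: s' then
    markov_prob s' * (if (k <= size s')%N then word_prob (a :: take k s') / word_prob (take k s') else 1)
  else 1.

Lemma markov_prob_ge0 s : 0 <= markov_prob s.
Proof.
elim: s => //= a s IH; rewrite mulr_ge0//.
by case: ifP => // _; rewrite divr_ge0// word_prob_ge0.
Qed.

Lemma sum_tuple_cons n (F : seq A -> R) :
  \sum_(t : n.+1.-tuple A) F t = \sum_(t : n.-tuple A) \sum_a F (a :: t).
Proof.
rewrite pair_bigA/=.
rewrite (reindex (fun p : n.-tuple A * A => [tuple of p.2 :: p.1]))//=.
exists (fun t : n.+1.-tuple A => ([tuple of behead t], thead t)).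
  move=> [t a] _ /=; congr (_, _); apply: val_inj => //=.
by move=> t _; rewrite /= -tuple_eta.
Qed.

Lemma sum_markov_prob n : \sum_(t : n.-tuple A) markov_prob t <= #|A|%:R ^+ k.
Proof.
have A1 : (1 : R) <= #|A|%:R by rewrite ler1n; apply/card_gt0P; exists a0.
(* This exponent lets the induction pass: the first [k] letters prefixed multiply the mass by [#|A|]
   each, every later one by at most 1. *)
suff : \sum_(t : n.-tuple A) markov_prob t <= #|A|%:R ^+ minn n k.
  by move=> /le_trans; apply; apply: ler_weXn2l => //; exact: geq_minr.
elim: n => [|n IH].
  rewrite min0n expr0 (big_pred1 [tuple])//.
  by move=> t; apply/esym/eqP; exact: tuple0.
rewrite sum_tuple_cons/=.
have [kn|nk] := leqP k n.
  have -> : minn n.+1 k = minn n k by lia.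
  apply: le_trans IH; apply: ler_sum => t _.
  under eq_bigr do rewrite size_tuple kn.
  rewrite -mulr_sumr ler_piMr ?markov_prob_ge0// -mulr_suml sum_word_prob_cons.
  (* Division by 0 gives 0, so after a null context the conditional weights sum to 0 instead of
     1. *)
  by have [->|P0] := eqVneq (word_prob (take k t)) 0; rewrite ?mul0r// divff.
have -> : minn n.+1 k = (minn n k).+1 by lia.
rewrite exprS mulrC; apply: le_trans (ler_wpM2r _ IH); last exact: le_trans A1.
rewrite mulr_suml; apply: ler_sum => t _.
under eq_bigr do rewrite size_tuple leqNgt nk/= mulr1.
by rewrite sumr_const mulr_natr.
Qed.

(** The conditional probability of the letter at 0 given the [k] letters to its right. *)
Let G (x : X) : R := word_prob (wseq k.+1 x) / word_prob (wseq k (T x)).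

Lemma markov_prob_wseq n x : markov_prob (wseq n x) = \prod_(i < n - k) G (iter i T x).
Proof.
elim: n x => [|n IH] x; first by rewrite sub0n big_ord0.
have Qcons a s : markov_prob (a :: s) =
    markov_prob s * (if (k <= size s)%N then word_prob (a :: take k s) / word_prob (take k s) else 1).
  by [].
rewrite wseqS Qcons size_mkseq IH; have [kn|nk] := leqP k n.
  rewrite subSn// big_ord_recl mulrC take_wseq// -wseqS.
  have -> : \prod_(i < n - k) G (iter i T (T x)) =
            \prod_(i < n - k) G (iter (lift ord0 i) T x).
    by apply: eq_bigr => i _; rewrite -iterSr.
  by [].
have -> : (n.+1 - k = 0)%N by apply/eqP; rewrite subn_eq0.
have -> : (n - k = 0)%N by apply/eqP; rewrite subn_eq0 ltnW.
by rewrite mulr1 !big_ord0.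
Qed.

(** A subword is at least as likely as the whole word, by invariance. This makes every factor
    [G (iter i T x)] positive, so that the logarithm of the product splits. *)
Lemma word_prob_iter_gt0 n x i : (i + k < n)%N -> 0 < word_prob (wseq n x) ->
  0 < word_prob (wseq k.+1 (iter i T x)) /\ 0 < word_prob (wseq k (iter i.+1 T x)).
Proof.
move=> ikn xn.
have sub m j y : (j + m <= n)%N ->
    wseq n y = wseq n x -> wseq m (iter j T y) = wseq m (iter j T x).
  move=> jmn e; apply: (@eq_from_nth _ a0); rewrite ?size_mkseq// => l lm.
  rewrite !nth_mkseq// !iter_sshift.
  have := congr1 (nth a0 ^~ (j + l)%N) e; rewrite /= !nth_mkseq; [|lia..].
  by rewrite (_ : (j + l)%N%:Z = l%:Z + j%:Z) //; lia.
have pos m j : (j + m <= n)%N -> 0 < word_prob (wseq m (iter j T x)).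
  move=> jmn; apply: lt_le_trans xn _; rewrite /word_prob !size_mkseq.
  have mS := measurable_wseq (wseq m (iter j T x)).
  rewrite size_mkseq in mS.
  rewrite -(invT_iter j mS); apply: le_fine_probability.
  - by have := measurable_wseq (wseq n x); rewrite size_mkseq.
  - exact: (measurable_iter measurable_sshift).
  - by move=> y /= /(sub m j y jmn).
by split; apply: pos; lia.
Qed.

Let g (x : X) : R := - ln (G x).

Let hg (t : k.+1.-tuple A) : R := - ln (word_prob t / word_prob (behead t)).

Let g_word : g = hg \o word 0 k.+1.
Proof. by apply/funext => x; rewrite /hg /= val_word wseqS /= -wseqS. Qed.

Lemma bmeas_g : bmeas g.
Proof. by rewrite g_word; apply: finite_rv_bmeas; exact: finite_rv_word. Qed.

(** The chain rule: [g] is the information of a letter given the next [k]. Off the null words the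
    logarithm of the quotient splits into the informations of a word and of its tail. *)
Lemma mean_g : mean mu g <= word_entropy k.+1 - word_entropy k.
Proof.
have fw := @finite_rv_word 0 k.+1.
pose h (t : k.+1.-tuple A) := - ln (word_prob t) + ln (word_prob (behead t)).
have hE : (fun x => info mu (word 0 k.+1) x + - info mu (word 1 k) x) =
    h \o word 0 k.+1.
  apply/funext => x; rewrite /info /h /= opprK (pr_word 1) !pr_wordE.
  congr (_ + ln (word_prob _)).
  rewrite val_word wseqS /= -val_word -[T x]/(iter 1 T x) word_shift.
  by rewrite add0r.
have -> : word_entropy k.+1 - word_entropy k = mean mu (h \o word 0 k.+1).
  rewrite -hE meanD; [|exact: bmeas_info|apply: bmeasN; exact: bmeas_info (@finite_rv_word _ _)].
  rewrite -(entropy_word 1 k) /word_entropy /entropy; congr (_ + _).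
  rewrite (_ : (fun x => - _) = (fun x => -1 * info mu (word 1 k) x)); last first.
    by apply/funext => x; rewrite mulN1r.
  by rewrite meanZ ?mulN1r//; exact: bmeas_info (@finite_rv_word _ _).
rewrite g_word.
apply: le_mean_finite_rv => // t p0; rewrite /h /hg.
have Pt : 0 < word_prob t by rewrite -pr_wordE.
suff Pbt : 0 < word_prob (behead t) by rewrite ln_div ?posrE// opprB addrC.
apply: lt_le_trans Pt _; rewrite -(sum_word_prob_cons (behead t)) (bigD1 (thead t))//=.
rewrite (_ : thead t :: behead t = t); last by rewrite [in RHS](tuple_eta t).
by rewrite lerDl sumr_ge0// => a _; exact: word_prob_ge0.
Qed.

Lemma ln_markov_prob n x : 0 < word_prob (wseq n x) ->
  0 < markov_prob (wseq n x) /\ - ln (markov_prob (wseq n x)) = \sum_(i < n - k) g (iter i T x).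
Proof.
move=> xn; rewrite markov_prob_wseq.
have Gp (i : 'I_(n - k)) : 0 < G (iter i T x).
  have [] := @word_prob_iter_gt0 n x i _ xn; first by have := ltn_ord i; lia.
  by move=> p1 p2; rewrite divr_gt0// -iterS.
split; first by apply: prodr_gt0 => i _; exact: Gp.
rewrite /g sumrN; congr (- _).
elim: (index_enum _) => [|i r IH]; first by rewrite !big_nil ln1.
by rewrite !big_cons lnM ?posrE ?IH// prodr_gt0.
Qed.

Lemma measurable_birkhoff (c : R) K n :
  measurable [set x | K < \sum_(i < n) (g (iter i T x) - c)].
Proof.
have bS : bmeas (fun x => \sum_(i < n) (g (iter i T x) - c)).
  apply: (mean_sum mu _).1 => i; apply: bmeasD; last exact: bmeas_cst.
  elim: (nat_of_ord i) => [|j IH]; first exact: bmeas_g.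
  under eq_fun do rewrite iterSr.
  exact: (bmeas_comp measurable_sshift IH).
rewrite (_ : [set _ | _] =
   (fun x => \sum_(i < n) (g (iter i T x) - c)) @^-1` `]K, +oo[).
  by rewrite -[X in measurable X]setTI; apply: bS.1.
by apply/seteqP; split => x /=; rewrite in_itv/= andbT.
Qed.

End Markov.

Lemma expN_small (C eta : R) : 0 < C -> 0 < eta -> expR (- (C / eta)) * C <= eta.
Proof.
move=> C0 e0; rewrite expRN mulrC ler_pdivrMr ?expR_gt0//.
have := expR_ge1Dx (C / eta) => h.
have := ler_wpM2l (ltW e0) h; rewrite mulrDr mulr1 [eta * (_ / _)]mulrC divfK ?gt_eqF//.
by lra.
Qed.

Hypothesis ergT : forall S : set X, measurable S -> T @^-1` S = S ->
  mu S = 0%E \/ mu S = 1%E.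

(* The upper half of the Shannon-McMillan theorem, in probability: up to a factor
   [e^(- n eps / 3)] the law of an [n]-word is bounded below by its Markov
   approximation of order [k], whose information is a Birkhoff sum. *)
Lemma info_upper (eps eta : R) : 0 < eps -> 0 < eta ->
  exists N, forall n, (N <= n)%N -> forall S : set X, measurable S ->
    S `<=` [set x | ~ (0 < word_prob (wseq n x) /\
                       - ln (word_prob (wseq n x)) <= n%:R * (rate + eps))] ->
    fine (mu S) <= eta.
Proof.
move=> e0 h0; have e30 : 0 < eps / 3 by rewrite divr_gt0.
have [k hk] := small_increment e30.
pose c := rate + eps / 3.
pose g (x : X) : R := - ln (word_prob (wseq k.+1 x) / word_prob (wseq k (T x))).
have bg : bmeas g := bmeas_g k.
have bf : bmeas (fun x => g x - c) by apply: bmeasD => //; exact: bmeas_cst.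
have f0 : mean mu (fun x => g x - c) < 0.
  rewrite meanD//; last exact: bmeas_cst.
  by rewrite mean_cst subr_lt0; apply: le_lt_trans (mean_g k) _.
have h20 : 0 < eta / 2 by rewrite divr_gt0.
have [K hK] := birkhoff_upper measurable_sshift invT ergT bf f0 h20.
pose C : R := #|A|%:R ^+ k.
have C0 : 0 < C by rewrite exprn_gt0// ltr0n; apply/card_gt0P; exists a0.
(* One third of [n * eps] is to exceed both summands: the first makes [beta * C <= eta / 2], the
   second absorbs the excess [K] of the Birkhoff sum. The other two thirds go to the choice of [k]
   and to [beta]. *)
pose Y := C / (eta / 2) + K%:R.
exists (Num.truncn (Y / (eps / 3))).+1 => n Nn S mS Sbad.
have Yn : Y <= n%:R * (eps / 3).
  rewrite -ler_pdivrMr//; apply: le_trans (ltW (truncnS_gt _)) _.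
  by rewrite ler_nat.
pose beta := expR (- (n%:R * (eps / 3))).
pose S2 := [set x | K%:R < \sum_(i < n - k) (g (iter i T x) - c)].
(* These words have total probability at most [beta] times the total Markov weight, hence at most
   [beta * C]. *)
pose D := [pred t : n.-tuple A | word_prob t <= beta * markov_prob k t].
pose S3 := word 0 n @^-1` [set t | t \in D].
have mS2 : measurable S2 by exact: measurable_birkhoff.
have mS3 : measurable S3 by apply: finite_rv_measurable; exact: finite_rv_word.
have muS2 : fine (mu S2) <= eta / 2 by exact: (hK (n - k)%N).
have muS3 : fine (mu S3) <= eta / 2.
  rewrite pr_pred; last exact: finite_rv_word.
  apply: (@le_trans _ _ (beta * C)).
    apply: (@le_trans _ _ (\sum_(t in D) beta * markov_prob k t)).
      by apply: ler_sum => t; rewrite inE pr_wordE.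
    apply: (@le_trans _ _ (\sum_(t : n.-tuple A) beta * markov_prob k t)).
      rewrite big_mkcond/=; apply: ler_sum => t _; case: ifP => // _.
      by rewrite mulr_ge0 ?expR_ge0 ?markov_prob_ge0.
    by rewrite -mulr_sumr ler_wpM2l ?expR_ge0//; exact: sum_markov_prob.
  apply: le_trans (expN_small C0 h20); rewrite ler_wpM2r ?(ltW C0)//.
  rewrite ler_expR lerN2; apply: le_trans Yn.
  by rewrite /Y lerDl.
have SU : S `<=` S2 `|` S3.
  move=> x /Sbad /= bad; apply: contrapT => /not_orP[xS2 xS3]; apply: bad.
  have : ~~ (word_prob (wseq n x) <= beta * markov_prob k (wseq n x)).
    by apply/negP => h; apply: xS3; rewrite /S3 /= inE /= val_word.
  rewrite -ltNge => PQ.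
  have P0 : 0 < word_prob (wseq n x).
    by apply: le_lt_trans PQ; rewrite mulr_ge0 ?expR_ge0 ?markov_prob_ge0.
  split => //; have [Q0 lnQ] := ln_markov_prob k P0.
  move: PQ; rewrite -ltr_ln ?posrE ?mulr_gt0 ?expR_gt0//.
  rewrite lnM ?posrE ?expR_gt0// expRK => PQ.
  have : \sum_(i < n - k) (g (iter i T x) - c) <= K%:R.
    by rewrite leNgt; apply/negP => h; apply: xS2.
  rewrite big_split/= -lnQ sumr_const card_ord -[_ *+ _]mulr_natr.
  have c0 : 0 <= c by rewrite addr_ge0 ?rate_ge0 ?ltW.
  have nk : (n - k)%:R * c <= n%:R * c by rewrite ler_wpM2r// ler_nat leq_subr.
  have KY : K%:R <= Y by rewrite /Y lerDr divr_ge0// ltW.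
  rewrite mulNr [c * _]mulrC => Kle.
  have : n%:R * c = n%:R * rate + n%:R * (eps / 3) by rewrite mulrDr.
  have -> : n%:R * (rate + eps) =
      n%:R * rate + n%:R * (eps / 3) + n%:R * (eps / 3) + n%:R * (eps / 3) by field.
  move: Kle PQ KY Yn nk; lra.
apply: (@le_trans _ _ (fine (mu (S2 `|` S3)))).
  by apply: le_fine_probability => //; exact: measurableU.
by apply: le_trans (fine_probabilityU2 mu mS2 mS3) _; move: muS2 muS3; lra.
Qed.

End Words.

(** * Limits superior in the extended reals *)

Section LimSup.
Context (R : realType).

Lemma limn_esup_le (u : nat -> \bar R) (l : \bar R) :
  (exists N, forall n, (N <= n)%N -> (u n <= l)%E) -> (limn_esup u <= l)%E.
Proof.
move=> [N hN]; rewrite /limn_esup /limf_esup.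
apply: ge_ereal_inf; exists (ereal_sup (u @` [set n | (N <= n)%N])).
  by exists [set n | (N <= n)%N] => //; exists N.
by apply: ge_ereal_sup => _ [n /hN un <-].
Qed.

Lemma limn_esup_lt (u : nat -> \bar R) (l : \bar R) :
  (limn_esup u < l)%E -> exists N, forall n, (N <= n)%N -> (u n < l)%E.
Proof.
rewrite /limn_esup /limf_esup => /ereal_inf_lt[_ [V [N _ NV] <-] Vl].
exists N => n /NV Vn; apply: le_lt_trans Vl.
by apply: ereal_sup_ubound; exists n.
Qed.

Lemma limn_esup_ge0 (u : nat -> \bar R) :
  (forall n, (0 <= u n)%E) -> (0 <= limn_esup u)%E.
Proof.
move=> u0; rewrite /limn_esup /limf_esup; apply: le_ereal_inf_tmp => _ [V [N _ NV] <-].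
by apply: le_trans (u0 N) _; apply: ereal_sup_ubound; exists N => //; apply: NV => /=.
Qed.

End LimSup.

(** * Kolmogorov-Sinai entropy *)

Section Partitions.
Context (R : realType) (A : finType) (a0 : A).
Local Notation X := (@Conf A a0).
Context (mu : probability X R).

Definition itinerary (S : X -> X) (I : finType) (n : nat) (u : X -> I) (x : X) :
  {ffun 'I_n -> I} := [ffun i : 'I_n => u (iter i S x)].

Lemma Hfam_itinerary (S : X -> X) k n (P : 'I_k -> set X) (u : X -> 'I_k) :
  (forall x i, P i x <-> u x = i) -> finite_rv (itinerary S n u) ->
  Hfam mu (@join A a0 S k n P) = entropy mu (itinerary S n u).
Proof.
move=> Pu fu; rewrite /Hfam entropyE//; congr (- _); apply: eq_bigr => w _.
rewrite /pr (_ : join _ _ _ = itinerary S n u @^-1` [set w]).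
  by rewrite /plogp; case: eqVneq => // ->; rewrite mul0r.
apply/seteqP; split => x /=.
  by move=> h; apply/ffunP => i; rewrite ffunE; apply/Pu; exact: h.
by move=> <- i; apply/Pu; rewrite ffunE.
Qed.

Lemma h_mu_ge0 (S : X -> X) : (0 <= h_mu mu S)%E.
Proof.
apply: (@le_trans _ _ (h_part mu S (fun _ : 'I_1 => setT))).
  apply: limn_esup_ge0 => n; rewrite lee_fin divr_ge0//.
  rewrite /Hfam oppr_ge0; apply: sumr_le0 => w _.
  rewrite (_ : join _ _ _ = setT); last by apply/seteqP; split.
  by rewrite [X in fine X]probability_setT /plogp oner_eq0 mul1r ln1.
apply: ereal_sup_ubound; exists 1%N, (fun=> setT); split => //; split => //.
- by move=> i j; rewrite !ord1 eqxx.
- by move=> x; exists ord0.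
Qed.

Lemma partition_index k (P : 'I_k -> set X) : is_partition P ->
  exists u : X -> 'I_k, finite_rv u /\ forall x i, P i x <-> u x = i.
Proof.
move=> [mP dP cP]; have [u uP] := choice cP.
have Pu x i : P i x <-> u x = i.
  split=> [Pix|<-//]; apply/eqP/negPn/negP => /(dP _ _) d0.
  by have : (P (u x) `&` P i) x by []; rewrite d0.
exists u; split => // i; rewrite (_ : _ @^-1` _ = P i)//.
by apply/seteqP; split => x /= /Pu.
Qed.

(** Partitions are indexed by ordinals, so the values of [u] are renumbered by [enum_rank]; being
    injective, this preserves the entropy of itineraries. *)
Lemma entropy_itinerary_le_h_mu (S : X -> X) (I : finType) (u : X -> I) :
  (forall n, finite_rv (itinerary S n u)) -> finite_rv u ->
  (limn_esup (fun n => (entropy mu (itinerary S n u) / n%:R)%:E) <= h_mu mu S)%E.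
Proof.
move=> fi fu.
pose v : X -> 'I_#|I| := enum_rank \o u.
pose P (i : 'I_#|I|) := v @^-1` [set i].
have fv : finite_rv v by exact: finite_rv_comp.
have vE n : itinerary S n v = (fun w : {ffun 'I_n -> I} => [ffun t => enum_rank (w t)])
    \o itinerary S n u.
  by apply/funext => x; apply/ffunP => t; rewrite !ffunE.
have fiv n : finite_rv (itinerary S n v) by rewrite vE; apply: finite_rv_comp.
apply: ereal_sup_ubound; exists #|I|, P; split.
  split => //.
  - move=> i j ij; apply/seteqP; split => // x [/= vi vj].
    by rewrite -vi -vj eqxx in ij.
  - by move=> x; exists (v x).
rewrite /h_part; congr (limn_esup _); apply/funext => n.
rewrite (@Hfam_itinerary S _ n P v)//; congr ((_ / _)%:E).
apply/eqP; rewrite eq_le; apply/andP; split; apply: entropy_le => //.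
  move=> x y /ffunP xy; apply/ffunP => t; have := xy t.
  by rewrite !ffunE => /enum_rank_inj.
by move=> x y; rewrite vE /= => ->.
Qed.

End Partitions.

(** * Entropy of the shift is at most the entropy rate of words *)

Section KolmogorovSinai.
Context (R : realType) (A : finType) (a0 : A).
Local Notation X := (@Conf A a0).
Local Notation T := (@sshift A a0).
Context (mu : probability X R).
Hypothesis invT : mu_invariant mu T.

(** With [I := Prop] this also covers sets determined by finitely many coordinates. *)
Definition window_fun (I : Type) (m : nat) (u : X -> I) :=
  forall x y : X, (forall j : int, `|j| <= m%:Z -> x j = y j) -> u x = u y.

Lemma window_funW (I : Type) (m m' : nat) (u : X -> I) : (m <= m')%N ->
  window_fun m u -> window_fun m' u.
Proof. by move=> mm' mu' x y xy; apply: mu' => j jm; apply: xy; lia. Qed.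

Lemma window_finite_rv (I : finType) m (u : X -> I) : window_fun m u -> finite_rv u.
Proof.
move=> mu' i; rewrite (_ : _ @^-1` _ =
    word (- m%:Z) (2 * m).+1 @^-1` (word (- m%:Z) (2 * m).+1 @` (u @^-1` [set i]))).
  by apply: finite_rv_measurable; exact: finite_rv_word.
apply/seteqP; split => x /=; first by move=> ux; exists x.
move=> [y uy /word_eq yx]; rewrite -uy; apply: mu' => j jm.
have := yx (absz (j + m%:Z)).
rewrite (_ : - m%:Z + (absz (j + m%:Z))%:Z = j); last by lia.
by move=> -> //; lia.
Qed.

(** The error is an exceptional set [N] instead of a symmetric difference, so the errors of several
    sets simply unite. *)
Definition approximable (B : set X) := measurable B /\ forall eps : R, 0 < eps ->
  exists m (D : set X) (N : set X), [/\ window_fun m D, measurable N,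
    fine (mu N) <= eps & forall x, ~ N x -> (B x <-> D x)].

Lemma approximable_setU2 B C : approximable B -> approximable C ->
  approximable (B `|` C).
Proof.
move=> [mB hB] [mC hC]; split; first exact: measurableU.
move=> eps e0; have e20 : 0 < eps / 2 by rewrite divr_gt0.
have [m [D [N [mD mN Ne ND]]]] := hB _ e20.
have [m' [D' [N' [mD' mN' Ne' ND']]]] := hC _ e20.
exists (maxn m m'), (D `|` D'), (N `|` N'); split.
- move=> x y xy; rewrite /setU/=.
  rewrite (window_funW (leq_maxl m m') mD xy).
  by rewrite (window_funW (leq_maxr m m') mD' xy).
- exact: measurableU.
- by apply: le_trans (fine_probabilityU2 mu mN mN') _; lra.
- by move=> x /not_orP[/ND BD /ND' CD]; split => -[/BD|/CD]; by [left|right].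
Qed.

(** A countable union is first cut to a finite one: the parts [V n] left out decrease to the empty
    set, hence in measure to 0. *)
Lemma approximable_sigma : sigma_algebra setT approximable.
Proof.
have a_0 : approximable set0.
  split => // eps e0; exists 0%N, set0, set0; split => //.
  by rewrite measure0 ltW.
split => //.
- move=> B [mB hB]; split; first exact: measurableD.
  move=> eps /hB[m [D [N [mD mN Ne ND]]]]; exists m, (~` D), N; split => //.
    by move=> x y /mD; rewrite /setC/= => ->.
  move=> x /ND BD; rewrite setTD; split => h h'; apply: h; exact/BD.
- move=> B hB; have mB k : measurable (B k) := (hB k).1.
  have mU : measurable (\bigcup_k B k) by exact: bigcupT_measurable.
  split => // eps e0; have e20 : 0 < eps / 2 by rewrite divr_gt0.
  pose U n := \big[setU/set0]_(i < n) B i.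
  have aU n : approximable (U n).
    rewrite /U; elim: n => [|n IH]; first by rewrite big_ord0.
    by rewrite big_ord_recr; exact: approximable_setU2.
  pose V n := \bigcup_k B k `\` U n.
  have mV n : measurable (V n) by apply: measurableD => //; exact: (aU n).1.
  have V0 : \bigcap_n V n = set0.
    apply/seteqP; split => // x hx; have [[k _ Bk] _] := hx 0%N I.
    have [_] := hx k.+1 I; apply.
    by rewrite /U big_ord_recr; right.
  have cV : mu (V n) @[n --> \oo] --> mu (\bigcap_n V n).
    apply: nonincreasing_cvg_mu => //.
    - exact: le_lt_trans (probability_le1 mu (mV 0)) (ltry _).
    - by rewrite V0.
    - move=> n n' nn'; apply/subsetPset => x [Bx nUx]; split => // Ux; apply: nUx.
      exact: (subset_bigsetU nn').
  rewrite V0 measure0 in cV.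
  have cfV : fine (mu (V n)) @[n --> \oo] --> (0 : R) by exact: fine_cvg cV.
  have /cvgrPdist_lt/(_ _ e20) [n _ /(_ n (leqnn n))] := cfV.
  rewrite /= sub0r normrN ger0_norm ?fine_ge0// => muV.
  have [m [D [N [mD mN Ne ND]]]] := (aU n).2 _ e20.
  exists m, D, (V n `|` N); split => //; first exact: measurableU.
    by apply: le_trans (fine_probabilityU2 mu (mV n) mN) _; lra.
  move=> x /not_orP[nV /ND UD]; rewrite -UD; split => [Bx|].
    by apply: contrapT => nU; apply: nV.
  by rewrite /U -bigcup_mkord => -[k _ Bk]; exists k.
Qed.

Lemma measurable_approximable (B : set X) : measurable B -> approximable B.
Proof.
apply: smallest_sub; first exact: approximable_sigma.
move=> C cC; split; first exact: sub_sigma_algebra.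
have [lo [L [w ->]]] := cC.
move=> eps e0; exists (absz lo + L)%N, [set x | forall k : 'I_L, x (lo + (k : nat)%:Z) = w k], set0.
split => //; last by rewrite measure0 ltW.
move=> x y xy; apply/propext; split => h k; rewrite -h; [apply/esym|]; apply: xy.
- have := ltn_ord k; lia.
- have := ltn_ord k; lia.
Qed.

Lemma approximable_finite_rv (k : nat) (u : X -> 'I_k) (eps : R) : finite_rv u -> 0 < eps ->
  exists m (v : X -> 'I_k) (N : set X), [/\ window_fun m v, measurable N,
    fine (mu N) <= eps & forall x, ~ N x -> u x = v x].
Proof.
case: k u => [u|k u]; first by case: (u point).
move=> fu e0; have ek0 : 0 < eps / k.+1%:R by rewrite divr_gt0.
have hi (i : 'I_k.+1) := (measurable_approximable (fu i)).2 _ ek0.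
have [m hm] := choice hi; have [D hD] := choice hm; have [N hN] := choice hD.
(* Off all the [N i] exactly one [D i] contains [x], that of [u x], so the default [ord0] can arise
   only on the exceptional set. *)
exists (\max_i m i)%N, (fun x => odflt ord0 [pick i | `[< D i x >]]),
  (\big[setU/set0]_i N i).
split.
- move=> x y xy; congr (odflt _ _); apply: eq_pick => i; congr (asbool _).
  have [mD _ _ _] := hN i.
  by apply: (window_funW _ mD) xy; exact: leq_bigmax.
- by apply: bigsetU_measurable => i _; have [] := hN i.
- apply: (@le_trans _ _ (\sum_(i < k.+1) eps / k.+1%:R)); last first.
    by rewrite sumr_const card_ord -mulrnAr -mulr_natr mulVf ?mulr1// pnatr_eq0.
  suff : measurable (\big[setU/set0]_i N i) /\
     fine (mu (\big[setU/set0]_i N i)) <= \sum_(i < k.+1) eps / k.+1%:R by case.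
  apply: (big_ind2 (fun (S : set X) (r : R) => measurable S /\ fine (mu S) <= r)).
  + by rewrite measure0.
  + move=> S r S' r' [mS Sr] [mS' Sr']; split; first exact: measurableU.
    by apply: le_trans (fine_probabilityU2 mu mS mS') _; exact: lerD.
  + by move=> i _; have [] := hN i.
- move=> x nN.
  have hx i : u x = i <-> D i x.
    have [_ _ _ h] := hN i; apply: h => Nx; apply: nN.
    by rewrite (bigD1 i)//=; left.
  case: pickP => [i /asboolP /hx ->//|/(_ (u x)) /asboolP []].
  exact/hx.
Qed.

Lemma mean_iter (I : finType) (w : X -> I) (h : I -> R) t : finite_rv w ->
  mean mu (h \o (w \o iter t T)) = mean mu (h \o w).
Proof.
move=> fw; rewrite !mean_finite_rv//; last exact: (finite_rv_iter (@measurable_sshift A a0) _ fw).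
by apply: eq_bigr => i _; rewrite pr_iter.
Qed.

Lemma finite_rv_itinerary n (I : finType) (u : X -> I) : finite_rv u -> finite_rv (itinerary T n u).
Proof. by move=> fu; apply: finite_rv_ffun => t; exact: (finite_rv_iter (@measurable_sshift A a0) _ fu). Qed.

(** The windows of length [2 m + 1] at [n] consecutive positions cover [n + 2 m] coordinates. *)
Lemma entropy_itinerary_window (I : finType) (v : X -> I) m n : window_fun m v ->
  entropy mu (itinerary T n v) <= word_entropy mu (n + 2 * m).
Proof.
move=> mv; have fv := window_finite_rv mv.
rewrite -(entropy_word invT (- m%:Z)); apply: entropy_le.
- exact: finite_rv_itinerary.
- exact: finite_rv_word.
move=> x y /word_eq xy; apply/ffunP => t; rewrite !ffunE; apply: mv => j jm.
rewrite !iter_sshift; have := xy (absz (j + t%:Z + m%:Z)).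
rewrite (_ : - m%:Z + (absz (j + t%:Z + m%:Z))%:Z = j + t%:Z); last by lia.
by apply; have := ltn_ord t; lia.
Qed.

Lemma ln_bound (t : R) : 0 < t -> t <= 1 / 2 -> - ln (1 - t ^+ 2) <= 2 * t ^+ 2.
Proof.
move=> t0 t1; have y0 : 0 < 1 - t ^+ 2 by nra.
rewrite -lnV ?posrE//.
have := @le_ln1Dx R ((1 - t ^+ 2)^-1 - 1); rewrite addrCA subrr addr0 => h.
apply: le_trans (h _) _; first by rewrite ltrBDr addNr invr_gt0.
have s14 : t ^+ 2 <= 1 / 4 by nra.
have s0 : 0 <= t ^+ 2 by exact: sqr_ge0.
rewrite lerBlDr -[leLHS]mul1r ler_pdivrMr//.
by move: s14 s0; set s := t ^+ 2; nra.
Qed.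

Lemma entropy_itinerary_le (k : nat) (u : X -> 'I_k.+1) (t : R) : finite_rv u -> 0 < t ->
  t <= 1 / 2 -> exists m, forall n, entropy mu (itinerary T n u) <=
    word_entropy mu (n + 2 * m) + n%:R * (t * (4 + ln k.+1%:R)).
Proof.
move=> fu t0 t12.
(* Why a square: a disagreement costs up to [ln k.+1 + 2 / t], as [- ln (t ^+ 2) <= 2 / t], and on
   mass [t ^+ 2] this averages to a multiple of [t]. *)
have t20 : 0 < t ^+ 2 by rewrite exprn_gt0.
have [m [v [N [mv mN Nt uv]]]] := approximable_finite_rv fu t20.
have fv := window_finite_rv mv.
exists m => n; apply: le_trans (lerD (entropy_itinerary_window n mv) (lexx _)).
(* [v] agrees with [u] outside a set of measure [t ^+ 2], where coding [u] costs a
   uniform letter. *)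
pose kappa (i j : 'I_k.+1) : R := if i == j then 1 - t ^+ 2 else t ^+ 2 / k.+1%:R.
pose c (i j : 'I_k.+1) : R := if i == j then 2 * t ^+ 2 else ln k.+1%:R + 2 / t.
have k0 : (0 : R) < k.+1%:R by rewrite ltr0n.
have lnk : (0 : R) <= ln k.+1%:R by rewrite ln_ge0// ler1n.
have y0 : 0 < 1 - t ^+ 2 by nra.
have kappa0 i j : 0 < kappa i j.
  by rewrite /kappa; case: ifP => // _; rewrite divr_gt0.
have kappa1 j : \sum_i kappa i j <= 1.
  apply: (@le_trans _ _ (\sum_(i : 'I_k.+1)
      ((if i == j then 1 - t ^+ 2 else 0) + t ^+ 2 / k.+1%:R))).
    apply: ler_sum => i _; rewrite /kappa; case: ifP => _; rewrite ?add0r//.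
    by rewrite lerDl divr_ge0// ltW.
  rewrite big_split/= -big_mkcond big_pred1_eq sumr_const card_ord.
  by rewrite -mulrnAr -mulr_natr mulVf ?pnatr_eq0// mulr1 subrK.
have kappac i j : - ln (kappa i j) <= c i j.
  rewrite /kappa /c; case: ifP => _; first exact: ln_bound.
  rewrite ln_div ?posrE// lnXn// opprB lerD2l -mulNrn -[leLHS]mulr_natl.
  by rewrite ler_wpM2l// -lnV ?posrE// ltW// ln_sublinear// invr_gt0.
have ker := entropy_kernel mu (@finite_rv_itinerary n _ u fu) (@finite_rv_itinerary n _ v fv)
  kappa0 kappa1 kappac.
apply: le_trans ker _; rewrite lerD2l.
have fuv := finite_rv_pair fu fv.
pose h (ij : 'I_k.+1 * 'I_k.+1) := c ij.1 ij.2.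
have bh (s : 'I_n) : bmeas (h \o (pair_rv u v \o iter s T)).
  by apply: finite_rv_bmeas; exact: (finite_rv_iter (@measurable_sshift A a0) _ fuv).
have -> : mean mu (fun x => \sum_s c (itinerary T n u x s) (itinerary T n v x s)) =
    mean mu (fun x => \sum_(s < n) (h \o (pair_rv u v \o iter s T)) x).
  congr (mean mu _); apply/funext => x; apply: eq_bigr => s _.
  by rewrite /h /= !ffunE.
rewrite (mean_sum mu bh).2; under eq_bigr do rewrite mean_iter//.
rewrite sumr_const card_ord -[leLHS]mulr_natl ler_wpM2l//.
have [bN eN] := mean_indic mu mN.
apply: (@le_trans _ _ (mean mu (fun x => 2 * t ^+ 2 + (ln k.+1%:R + 2 / t) * \1_N x))).
  apply: le_mean; first exact: finite_rv_bmeas.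
    by apply: bmeasD; [exact: bmeas_cst|apply: bmeasM => //; exact: bmeas_cst].
  move=> x; rewrite /h /c /= indicE.
  have d0 : 0 <= ln k.+1%:R + 2 / t by rewrite addr_ge0// divr_ge0// ltW.
  case: ifP => [_|/negP uxv]; first by rewrite lerDl mulr_ge0// ler0n.
  rewrite mem_set ?mulr1; first by rewrite lerDr mulr_ge0// ltW.
  by apply: contrapT => /uv e; apply: uxv; rewrite e.
rewrite meanD ?mean_cst ?meanZ// ?eN; [|exact: bmeas_cst|by apply: bmeasM => //; exact: bmeas_cst].
have d0 : 0 <= ln k.+1%:R + 2 / t by rewrite addr_ge0// divr_ge0// ltW.
apply: (@le_trans _ _ (2 * t ^+ 2 + (ln k.+1%:R + 2 / t) * t ^+ 2)).
  by rewrite lerD2l ler_wpM2l.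
have -> : (ln k.+1%:R + 2 / t) * t ^+ 2 = ln k.+1%:R * t ^+ 2 + 2 * t.
  by field; rewrite gt_eqF.
have tt : t ^+ 2 <= t by nra.
by have := ler_wpM2l lnk tt; rewrite mulrDr [t * ln _]mulrC; lra.
Qed.

Lemma h_mu_le_rate : (h_mu mu T <= (rate mu)%:E)%E.
Proof.
apply: ge_ereal_sup => _ [k [P [partP ->]]].
have [u [fu Pu]] := partition_index partP.
case: k P partP u fu Pu => [P _ u|k P partP u fu Pu]; first by case: (u point).
apply/lee_addgt0Pr => e e0.
have lnk : (0 : R) <= ln k.+1%:R by rewrite ln_ge0// ler1n.
have e30 : 0 < e / 3 by rewrite divr_gt0.
pose t := Num.min (1 / 2) (e / 3 / (4 + ln k.+1%:R)).
have d0 : 0 < 4 + ln k.+1%:R :> R by lra.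
have t0 : 0 < t by rewrite lt_min !divr_gt0.
have t12 : t <= 1 / 2 by rewrite ge_min lexx.
have te : t * (4 + ln k.+1%:R) <= e / 3.
  by rewrite -ler_pdivlMr// ge_min lexx orbT.
have [m hm] := entropy_itinerary_le fu t0 t12.
have [N hN] := fekete invT e30.
(* The cost of the [2 * m] extra letters, independent of [n]; it takes the last third of [e], after
   [t] and [fekete]. *)
pose C := (2 * m)%:R * (rate mu + e / 3).
apply: limn_esup_le; exists (maxn N (Num.truncn (C / (e / 3))).+1) => n Nn.
have n0 : (0 : R) < n%:R by rewrite ltr0n; lia.
rewrite (Hfam_itinerary mu Pu); last exact: finite_rv_itinerary.
rewrite -EFinD lee_fin ler_pdivrMr//; apply: le_trans (hm n) _.
apply: le_trans (lerD (hN (n + 2 * m)%N _) (lexx _)) _; first by lia.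
have Cn : C <= n%:R * (e / 3).
  rewrite -ler_pdivrMr//; apply: le_trans (ltW (truncnS_gt _)) _.
  by rewrite ler_nat; move: Nn; rewrite geq_max => /andP[].
have := ler_wpM2l (ltW n0) te; rewrite natrD mulrDl -/C.
move: Cn; set Z := n%:R * (t * _); nra.
Qed.

End KolmogorovSinai.

(** * The density flow *)

Section DensityFlowBound.
Context (R : realType) (A : finType) (a0 : A).
Local Notation X := (@Conf A a0).
Local Notation T := (@sshift A a0).
Context (mu : probability X R).

Lemma measurable_CA r (f : ('I_(2 * r).+1 -> A) -> A) :
  measurable_fun setT (@CA A a0 r f).
Proof.
apply: (@measurability _ _ _ _ setT (@CA A a0 r f) (@cylinders A a0)) => //.
move=> _ [_ [lo [L [w ->]] <-]]; rewrite setTI.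
rewrite (_ : _ @^-1` _ = \bigcap_(k in [set: 'I_L])
    ((fun x : X => CA f x (lo + (k : nat)%:Z)) @^-1` [set w k])); last first.
  by apply/seteqP; split => x /= h k; [move=> _|]; exact: h.
apply: fin_bigcap_measurable => // k _.
pose j := lo + (k : nat)%:Z.
rewrite (_ : (fun x : X => CA f x j) = (fun v : {ffun 'I_(2 * r).+1 -> A} => f v) \o
    (fun x : X => [ffun i : 'I_(2 * r).+1 => x (j - r%:Z + (i : nat)%:Z)])).
  have fv : finite_rv (fun x : X => [ffun i : 'I_(2 * r).+1 => x (j - r%:Z + (i : nat)%:Z)]).
    by apply: finite_rv_ffun => i; exact: finite_rv_coord.
  exact: (finite_rv_comp (fun v : {ffun 'I_(2 * r).+1 -> A} => f v) fv).
apply/funext => x /=; rewrite /CA; congr f; apply/funext => i.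
by rewrite ffunE.
Qed.

Context (F : X -> X) (mF : measurable_fun setT F).
Context (a b : nat -> nat).
Local Notation gp := (fun n (_ : X) => a n).
Local Notation gm := (fun n (_ : X) => b n).

Definition winlen n p : nat := (a n + b n + 2 * p).+1.
Local Notation lo n p := (- (a n)%:Z - p%:Z).
Local Notation win n p := (word (- (a n)%:Z - p%:Z) (winlen n p) : X -> (winlen n p).-tuple A).

Lemma Gcyl_win n p (x : X) : Gcyl gp gm n p x x = win n p @^-1` [set win n p x].
Proof.
apply/seteqP; split => z /=.
  by move=> h; apply/word_eq => k kn; apply: h; rewrite /Jlo /Jhi; rewrite /winlen in kn; lia.
move=> /word_eq h j; rewrite /Jlo /Jhi => jJ.
have := h (absz (j + (a n)%:Z + p%:Z)).
rewrite (_ : - (a n)%:Z - p%:Z + (absz (j + (a n)%:Z + p%:Z))%:Z = j); last by lia.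
by apply; rewrite /winlen; lia.
Qed.

Lemma ln_Gcyl n p (x : X) : - ln (fine (mu (Gcyl gp gm n p x x))) = info mu (win n p) x.
Proof. by rewrite Gcyl_win. Qed.

Lemma restr_eq n p (x y z : X) :
  restr gp gm n p x y = restr gp gm n p x z <-> win n p y = win n p z.
Proof.
split=> [/ffunP h|/word_eq h].
  by apply/word_eq => k kn; have := h (Ordinal kn); rewrite !ffunE.
by apply/ffunP => k; rewrite !ffunE; apply: h; exact: ltn_ord.
Qed.

(** Meant for [eta], an infimum that need not be attained: the deviation takes finitely many values
    on windows of fixed length, so a bound slightly above [eta] admits the same words as [eta]. *)
Lemma exists_gap (I : finType) (g : I -> R) (r : R) :
  exists2 e : R, 0 < e & forall i, r < g i -> r + e <= g i.
Proof.
suff [e e0 he] : exists2 e : R, 0 < e &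
    forall i, i \in enum I -> r < g i -> r + e <= g i.
  by exists e => // i; apply: he; rewrite mem_enum.
elim: (enum I) => [|i s [e e0 IH]]; first by exists 1.
have [gi|gi] := leP (g i) r.
  exists e => // j; rewrite inE => /predU1P[->|/IH//].
  by rewrite ltNge gi.
exists (Num.min e (g i - r)); first by rewrite lt_min e0 subr_gt0.
move=> j; rewrite inE => /predU1P[-> _|js rj].
  by rewrite -lerBrDl ge_min lexx orbT.
apply: le_trans (IH _ js rj); by rewrite lerD2l ge_min lexx.
Qed.

Let dist n p (t : (winlen n p).-tuple A) : R :=
  `|- ln (pr mu (win n p) t) / (a n + b n + 1)%:R - fine (h_mu mu T)|.

(* Only this lower bound on the mass of [XG] is needed, never [eta -> 0]: a larger
   [eta] only increases the number of words counted. *)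
Lemma XG_word n p delta : exists E : set ((winlen n p).-tuple A),
  XG mu gp gm n delta p = win n p @^-1` E /\
  (0 < delta -> ((1 - delta)%:E <= mu (win n p @^-1` E))%E).
Proof.
have distE x : `|Defs.ratio mu gp gm p n x - fine (h_mu mu T)| = dist (win n p x).
  by rewrite /Defs.ratio ln_Gcyl.
exists [set t | ((dist t)%:E <= Defs.eta mu gp gm p n delta)%E]; split.
  by apply/seteqP; split => x; rewrite /XG /= distE.
move=> d0.
set E := [set t | _].
have mE : measurable (win n p @^-1` E) by apply: finite_rv_measurable; exact: finite_rv_word.
have eta0 : (0 <= Defs.eta mu gp gm p n delta)%E.
  by apply: le_ereal_inf_tmp => _ [e [e0 _] <-]; rewrite lee_fin ltW.
(* If no [e] is admissible, the infimum is [+oo] and [XG] is the whole space. *)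
case etaE : (Defs.eta mu gp gm p n delta) eta0 => [r| |]//= _; last first.
  rewrite (_ : _ @^-1` _ = setT); last by apply/seteqP; split => // x _; rewrite /E /= etaE leey.
  by rewrite probability_setT lee_fin; lra.
have [e e0 he] := exists_gap (@dist n p) r.
have : (Defs.eta mu gp gm p n delta < (r + e)%:E)%E by rewrite etaE lte_fin ltrDl.
move=> /ereal_inf_lt[_ [e' [e'0 [S [mS dS hS]]] <-]]; rewrite lte_fin => e're.
apply: le_trans dS _; apply: le_measure; rewrite ?inE//.
move=> x Sx; rewrite /E /= etaE lee_fin leNgt; apply/negP => /he.
have := hS x Sx n (leqnn n); rewrite distE => h1 h2.
by have := lt_le_trans (lt_trans h1 e're) h2; rewrite ltxx.
Qed.

(** The window word in the type of [restr]. As the speed is the same at all points, [Jlen n p x]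
    reduces to [winlen n p], and words of different points become comparable. *)
Let wff n p (x : X) : {ffun 'I_(winlen n p) -> A} :=
  [ffun k : 'I_(winlen n p) => x (lo n p + (k : nat)%:Z)].

Let finite_rv_wff n p : finite_rv (@wff n p).
Proof. by apply: finite_rv_ffun => k; exact: finite_rv_coord. Qed.

Let wff_win n p (x y : X) : wff n p x = wff n p y <-> win n p x = win n p y.
Proof. exact: (@restr_eq n p x x y). Qed.

Definition orbit_word (n p : nat) (x : X) := itinerary F n.+1 (word (- p%:Z) (2 * p).+1) x.

Lemma finite_rv_itineraryF n (I : finType) (u : X -> I) : finite_rv u -> finite_rv (itinerary F n u).
Proof. by move=> fu; apply: finite_rv_ffun => t; exact: (finite_rv_iter mF _ fu). Qed.

Lemma finite_rv_orbit_word n p : finite_rv (orbit_word n p).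
Proof. by apply: finite_rv_itineraryF; exact: finite_rv_word. Qed.

Lemma alphaF_orbit n p x y : alphaF F n p x y <-> orbit_word n p y = orbit_word n p x.
Proof.
split=> h.
  apply/ffunP => i; rewrite !ffunE; apply/word_eq => k kp; apply: h; last by lia.
  by have := ltn_ord i; lia.
move=> i ni j jp; have /ffunP/(_ (inord i)) := h.
rewrite !ffunE inordK// => /word_eq/(_ (absz (j + p%:Z))).
rewrite (_ : - p%:Z + (absz (j + p%:Z))%:Z = j); last by lia.
by apply; lia.
Qed.

Local Notation words n delta p x := (TGwords mu F gp gm n delta p x).

Lemma TGwords_orbit n delta p x y : orbit_word n p x = orbit_word n p y ->
  words n delta p x = words n delta p y.
Proof.
move=> xy; apply/setP => w; rewrite !inE; apply/asboolP/asboolP.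
- move=> [z [[[y' [/alphaF_orbit ay' ry']] Xz] zw]]; exists z; split => //; split => //.
  by exists y'; split => //; apply/alphaF_orbit; rewrite ay'.
- move=> [z [[[y' [/alphaF_orbit ay' ry']] Xz] zw]]; exists z; split => //; split => //.
  by exists y'; split => //; apply/alphaF_orbit; rewrite ay'.
Qed.

Let logT n delta p (x : X) : R := ln #|words n delta p x|%:R.

(** A representative point turns what is constant on the classes of [alphaF] into a function of the
    finite-valued orbit word. *)
Let rep n p w : X := get [set x | orbit_word n p x = w].

Let rep_orbit n p x : orbit_word n p (rep (orbit_word n p x)) = orbit_word n p x.
Proof. by apply: (@getPex _ [set y | orbit_word n p y = orbit_word n p x]); exists x. Qed.

Lemma bmeas_logT n delta p : bmeas (logT n delta p).
Proof.
rewrite (_ : logT n delta p =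
  (fun w => logT n delta p (rep w)) \o orbit_word n p).
  by apply: finite_rv_bmeas; exact: finite_rv_orbit_word.
apply/funext => x; rewrite /logT /=.
by rewrite (TGwords_orbit delta (rep_orbit n p x)).
Qed.

Lemma logT_ge0 n delta p x : 0 <= logT n delta p x.
Proof.
rewrite /logT; have [->|t0] := posnP #|words n delta p x|; first by rewrite ln0.
by rewrite ln_ge0// ler1n.
Qed.

Lemma ln_card_words n p :
  ln #|{ffun 'I_(winlen n p) -> A}|%:R = (winlen n p)%:R * ln #|A|%:R :> R.
Proof.
have A0 : (0 < #|A|)%N by apply/card_gt0P; exists a0.
by rewrite card_ffun card_ord natrX lnXn ?ltr0n// mulr_natl.
Qed.

Lemma logT_le n delta p x : logT n delta p x <= (winlen n p)%:R * ln #|A|%:R.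
Proof.
have A0 : (0 < #|A|)%N by apply/card_gt0P; exists a0.
rewrite -ln_card_words /logT; have [->|t0] := posnP #|words n delta p x|.
  by rewrite ln0// ln_card_words mulr_ge0// ln_ge0// ler1n.
rewrite ler_ln ?posrE ?ltr0n//; last by apply/card_gt0P; exists [ffun=> a0].
by rewrite ler_nat; exact: max_card.
Qed.

Hypothesis invT : mu_invariant mu T.

(** [entropy_count] for the window word given the orbit word, with [D] the words of points of [XG];
    words outside [D] are charged as arbitrary words of the window. *)
Lemma mean_logT_ge n delta p : 0 < delta ->
  word_entropy mu (winlen n p) <= entropy mu (orbit_word n p) + mean mu (logT n delta p)
    + delta * ((winlen n p)%:R * ln #|A|%:R) + ln 2.
Proof.
move=> d0; have [E [XE muE]] := XG_word n p delta.
have fwin : finite_rv (win n p) by exact: finite_rv_word.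
rewrite -(entropy_word invT (lo n p)).
apply: (@le_trans _ _ (entropy mu (wff n p))).
  by apply: entropy_le => // x y /wff_win.
pose D : {set {ffun 'I_(winlen n p) -> A}} :=
  [set w | `[< exists z, XG mu gp gm n delta p z /\ wff n p z = w >]]%SET.
have DX x : wff n p x \in D <-> XG mu gp gm n delta p x.
  rewrite inE; split=> [/asboolP[z [Xz /wff_win zx]]|Xx].
    by move: Xz; rewrite XE /= zx.
  by apply/asboolP; exists x.
pose t w : {set {ffun 'I_(winlen n p) -> A}} := words n delta p (@rep n p w).
apply: le_trans (entropy_count (t := t) (D := D) mu (@finite_rv_wff n p) (@finite_rv_orbit_word n p) _) _.
  (* The point [x] is its own witness: it shares its orbit word with the representative. *)
  move=> x /DX Xx; rewrite /t inE; apply/asboolP; exists x; split => //; split => //.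
  by exists x; split => //; apply/alphaF_orbit; rewrite rep_orbit.
rewrite lerD2r; apply: lerD.
  rewrite lerD2l; rewrite (_ : (fun x => _) = logT n delta p)//.
  apply/funext => x; rewrite /logT /t.
  by rewrite (TGwords_orbit delta (rep_orbit n p x)).
rewrite ln_card_words ler_wpM2r//.
  by rewrite mulr_ge0// ln_ge0// ler1n; apply/card_gt0P; exists a0.
have mXG : measurable (win n p @^-1` E) by exact: finite_rv_measurable.
rewrite (_ : _ @^-1` _ = ~` (win n p @^-1` E)); last first.
  apply/seteqP; split => x /=.
    by move=> /negP h Ex; apply: h; apply/DX; rewrite XE.
  by move=> h; apply/negP => /DX; rewrite XE.
have := muE d0; rewrite probability_setC// (probability_fine mu mXG).
rewrite -EFinB lee_fin /=; lra.
Qed.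

Lemma entropy_full (I : finType) (u : X -> I) i : finite_rv u -> pr mu u i = 1 ->
  entropy mu u = 0.
Proof.
move=> fu u1; rewrite entropyE// big1 ?oppr0// => j _.
have [->|ji] := eqVneq j i; first by rewrite u1 ln1 mulr0.
have := sum_pr mu fu; rewrite (bigD1 i)//= u1 -[RHS]addr0 => /addrI.
move=> /psumr_eq0P h; rewrite h ?mul0r//.
by move=> k _; exact: pr_ge0.
Qed.

Lemma Mnpd_mean n p delta : Mnpd mu F gp gm n p delta =
  (mean mu (fun x => 1 - logT n delta p x / info mu (win n p) x))%:E /\
  bmeas (fun x => 1 - logT n delta p x / info mu (win n p) x).
Proof.
have fwin : finite_rv (win n p) by exact: finite_rv_word.
have bq : bmeas (fun x => 1 - logT n delta p x / info mu (win n p) x).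
  apply: bmeasD; first exact: bmeas_cst.
  apply: bmeasN; apply: bmeasM; first exact: bmeas_logT.
  exact: (finite_rv_bmeas (fun t => (- ln (pr mu (win n p) t))^-1) fwin).
split => //; rewrite -(mean_EFin mu bq) /Mnpd.
by apply: eq_integral => x _; rewrite ln_Gcyl.
Qed.

(** Off [bad] the denominator may be enlarged to [C], a constant, which reduces the integral to the
    mean of [logT]. On [bad] the term [L * \1_bad] compensates for [logT], which never exceeds
    [L]. *)
Lemma Mnpd_le n p delta (eps beta : R) (bad : set X) : 0 < delta -> 0 < eps ->
  0 < rate mu ->
  measurable bad -> fine (mu bad) <= beta ->
  (forall x, ~ bad x -> 0 < pr mu (win n p) (win n p x) /\
     info mu (win n p) x <= (winlen n p)%:R * (rate mu + eps)) ->
  (Mnpd mu F gp gm n p delta <=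
   ((eps + entropy mu (orbit_word n p) / (winlen n p)%:R
     + (delta + beta) * ln #|A|%:R + ln 2 / (winlen n p)%:R) / (rate mu + eps))%:E)%E.
Proof.
move=> d0 e0 h0 mbad mubad good.
have [-> bq] := Mnpd_mean n p delta; rewrite lee_fin.
have fwin : finite_rv (win n p) by exact: finite_rv_word.
have N0 : (0 : R) < (winlen n p)%:R by rewrite ltr0n.
pose L : R := (winlen n p)%:R * ln #|A|%:R.
pose C : R := (winlen n p)%:R * (rate mu + eps).
have C0 : 0 < C by rewrite mulr_gt0// addr_gt0.
have [bB eB] := mean_indic mu mbad.
have bT := bmeas_logT n delta p.
have bLB : bmeas (fun x => L * \1_bad x) by apply: bmeasM => //; exact: bmeas_cst.
have bTB : bmeas (fun x => - logT n delta p x + L * \1_bad x).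
  by apply: bmeasD => //; exact: bmeasN.
have step : mean mu (fun x => 1 - logT n delta p x / info mu (win n p) x) <=
    mean mu (fun x => 1 + C^-1 * (- logT n delta p x + L * \1_bad x)).
  apply: le_mean => //.
    by apply: bmeasD; [exact: bmeas_cst|apply: bmeasM => //; exact: bmeas_cst].
  move=> x; rewrite lerD2l indicE.
  have T0 := logT_ge0 n delta p x; have TL := logT_le n delta p x.
  have i0 := info_ge0 mu x fwin.
  have [bx|nbx] := pselect (bad x).
    rewrite mem_set// mulr1; apply: (@le_trans _ _ 0).
      by rewrite oppr_le0 divr_ge0.
    by rewrite mulr_ge0 ?invr_ge0 ?(ltW C0)// addrC subr_ge0.
  rewrite memNset// mulr0 addr0 mulrN lerN2 mulrC ler_wpM2l//.
  have [p0 iC] := good x nbx.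
  (* A vanishing denominator would give the quotient the value 0. It would mean a word of
     probability 1, hence zero entropy of the window word, against [0 < rate mu]. *)
  have ip : 0 < info mu (win n p) x.
    rewrite lt_neqAle i0 andbT; apply/negP => /eqP /esym /eqP.
    rewrite oppr_eq0 ln_eq0// => /eqP p1.
    have := rate_le mu (winlen n p); rewrite -(entropy_word invT (lo n p)).
    rewrite (entropy_full fwin p1) leNgt => /negP; apply.
    by rewrite mulr_gt0.
  by rewrite lef_pV2 ?posrE.
apply: le_trans step _.
rewrite meanD; [|exact: bmeas_cst|by apply: bmeasM => //; exact: bmeas_cst].
rewrite mean_cst meanZ// meanD//; last exact: bmeasN.
rewrite meanZ// eB.
have -> : mean mu (fun x => - logT n delta p x) = - mean mu (logT n delta p).
  rewrite (_ : (fun x => - _) = fun x => -1 * logT n delta p x).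
    by rewrite meanZ// mulN1r.
  by apply/funext => x; rewrite mulN1r.
have := mean_logT_ge n p d0; rewrite -/L => hT.
have hr := rate_le mu (winlen n p).
have L0 : 0 <= L.
  by rewrite mulr_ge0// ln_ge0// ler1n; apply/card_gt0P; exists a0.
have hb := ler_wpM2l L0 mubad.
rewrite ler_pdivlMr ?addr_gt0//.
rewrite -(ler_pM2l N0) mulrA [_%:R * (1 + _)]mulrC -mulrA -/C mulrDl mul1r.
rewrite mulrAC mulVf ?gt_eqF// mul1r.
set N := (winlen n p)%:R; set H := entropy mu _; set la := ln _.
have -> : N * (eps + H / N + (delta + beta) * la + ln 2 / N) =
    N * eps + H + (delta + beta) * (N * la) + ln 2.
  by field; rewrite gt_eqF.
move: hT hr hb; rewrite /C /L -/N -/la -/H; nra.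
Qed.

End DensityFlowBound.

(** * Speeds with real slopes *)

Section SpeedBound.
Context (R : realType) (A : finType) (a0 : A).
Local Notation X := (@Conf A a0).
Local Notation T := (@sshift A a0).
Context (mu : probability X R) (F : X -> X) (mF : measurable_fun setT F).
Context (vp vm : R) (vp0 : 0 <= vp) (vm0 : 0 <= vm).
Hypothesis invT : mu_invariant mu T.
Hypothesis ergT : forall S : set X, measurable S -> T @^-1` S = S ->
  mu S = 0%E \/ mu S = 1%E.

Let a n := absz (Num.ceil (vp * n%:R)).
Let b n := absz (Num.ceil (vm * n%:R)).

Lemma winlen_ge n p : (vp + vm) * n%:R <= (winlen a b n p)%:R.
Proof.
have ceil_le (r : R) : 0 <= r -> r <= (absz (Num.ceil r))%:R.
  move=> r0; apply: le_trans (ceil_ge r) _.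
  by rewrite natr_absz ler_int ler_norm.
rewrite mulrDl /winlen -natr1 !natrD.
have := ceil_le _ (mulr_ge0 vp0 (ler0n R n)).
have := ceil_le _ (mulr_ge0 vm0 (ler0n R n)).
by rewrite -/(a n) -/(b n); have := ler0n R (2 * p); lra.
Qed.

(** The windows [J_n] start at a place depending on [n], so [N] must not depend on [lo]. The bad set
    is described by words alone, and invariance gives it the same mass at every position. *)
Lemma win_info_upper (eps eta : R) : 0 < eps -> 0 < eta ->
  exists N, forall lo n, (N <= n)%N -> exists bad : set X,
    [/\ measurable bad, fine (mu bad) <= eta &
     forall x : X, ~ bad x -> 0 < pr mu (@word A a0 lo n) (word lo n x) /\
       info mu (@word A a0 lo n) x <= n%:R * (rate mu + eps)].
Proof.
move=> e0 h0; have [N hN] := info_upper invT ergT e0 h0.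
exists N => lo n Nn.
pose D := [pred t : n.-tuple A |
  ~~ ((0 < word_prob mu t) && (- ln (word_prob mu t) <= n%:R * (rate mu + eps)))].
have fw l : finite_rv (word l n : X -> _) by exact: finite_rv_word.
exists (@word A a0 lo n @^-1` [set t | t \in D]); split.
- exact: finite_rv_measurable.
- rewrite pr_pred//; under eq_bigr do rewrite pr_word//.
  rewrite -pr_pred//; apply: (hN n Nn); first exact: finite_rv_measurable.
  by move=> x; rewrite /= inE /= val_word => /negP h [p0 pi]; apply: h; rewrite p0 pi.
- move=> x; rewrite /= inE /= => /negP; rewrite negbK => /andP[p0 pi].
  by rewrite /info pr_word// pr_wordE.
Qed.

Lemma M_mu_v_le (l : R) : 0 < vp + vm -> 0 < rate mu ->
  h_mu mu F = l%:E -> (M_mu_v mu F vp vm <= (l / ((vp + vm) * rate mu))%:E)%E.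
Proof.
move=> v0 h0 hF.
have l0 : 0 <= l by have := h_mu_ge0 mu F; rewrite hF.
apply: ge_ereal_sup => _ [p _ <-]; apply/lee_addgt0Pr => e e0.
set v := vp + vm; set h := rate mu; set la : R := ln #|A|%:R.
have la0 : 0 <= la by rewrite ln_ge0// ler1n; apply/card_gt0P; exists a0.
(* Collects the multiples of [eps]: one from [Mnpd_le], one for all terms of order [1 / N], [v^-1]
   from approximating [l], and [2 * la] from [delta] and the bad set. *)
pose K := 2 + v^-1 + 2 * la.
have K0 : 0 < K.
  have v'0 : 0 < v^-1 by rewrite invr_gt0.
  by rewrite /K; lra.
(* The second entry makes the total error [eps * K / h] at most [e]; the first lets [eps] also bound
   the range of [delta] in [limsup_delta0]. *)
pose eps := Num.min 1 (e * h / K).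
have eps0 : 0 < eps by rewrite lt_min ltr01 divr_gt0// mulr_gt0.
have epsK : eps * K <= e * h by rewrite -ler_pdivlMr// ge_min lexx orbT.
apply: ge_ereal_inf; eexists; first by exists eps; [rewrite /= eps0 ge_min lexx|reflexivity].
apply: ge_ereal_sup => _ [d /= /andP[d0 de] <-].
apply: limn_esup_le.
pose w : X -> (2 * p).+1.-tuple A := word (- p%:Z) (2 * p).+1.
have [N1 hN1] : exists N, forall n, (N <= n)%N ->
    ((entropy mu (itinerary F n w) / n%:R)%:E < (l + eps)%:E)%E.
  apply: limn_esup_lt; apply: le_lt_trans (entropy_itinerary_le_h_mu _ _ _) _.
  - by move=> n; apply: (finite_rv_itineraryF mF); exact: finite_rv_word.
  - exact: finite_rv_word.
  - by rewrite hF lte_fin ltrDl.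
have [N2 hN2] := win_info_upper eps0 eps0.
have ln2 : 0 <= ln 2 :> R by rewrite ln_ge0// ler1n.
pose C := N2%:R + (l + eps + ln 2) / eps.
exists (maxn N1 (Num.truncn (C / v)).+1) => n; rewrite geq_max => /andP[N1n Cn].
set N : R := (winlen a b n p)%:R.
have N0 : 0 < N by rewrite ltr0n.
have vN : v * n%:R <= N := winlen_ge n p.
have CN : C <= N.
  apply: le_trans vN; rewrite mulrC -ler_pdivrMr//.
  by apply: le_trans (ltW (truncnS_gt _)) _; rewrite ler_nat.
have C20 : 0 <= (l + eps + ln 2) / eps by rewrite divr_ge0 ?(ltW eps0)// !addr_ge0// ltW.
have N2N : (N2 <= winlen a b n p)%N.
  by rewrite -(ler_nat R) -/N; apply: le_trans CN; rewrite lerDl.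
have CeN : (l + eps + ln 2) / N <= eps.
  rewrite ler_pdivrMr// mulrC -ler_pdivrMr//; apply: le_trans CN.
  by rewrite lerDr ler0n.
have [bad [mbad mubad good]] := hN2 (- (a n)%:Z - p%:Z) _ N2N.
apply: le_trans (Mnpd_le mF invT d0 eps0 h0 mbad mubad good) _.
rewrite -EFinD lee_fin -/N -/la -/h.
have HN : entropy mu (orbit_word F n p) / N <= (l + eps) / v + (l + eps) / N.
  (* The orbit word covers the [n.+1] times from 0 to [n]; the extra time gives the term
     [(l + eps) / N]. *)
  have := hN1 n.+1 (leqW N1n); rewrite lte_fin ltr_pdivrMr// => /ltW hH.
  apply: le_trans (ler_wpM2r _ hH) _; first by rewrite invr_ge0 ltW.
  rewrite -natr1 mulrDr mulr1 mulrDl lerD2r -mulrA.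
  apply: ler_wpM2l; first by rewrite addr_ge0// ltW.
  by rewrite ler_pdivrMr// mulrC ler_pdivlMr// mulrC.
have num : eps + entropy mu (orbit_word F n p) / N + (d + eps) * la + ln 2 / N <=
    l / v + eps * K.
  have dla : d * la <= eps * la by rewrite ler_wpM2r// ltW.
  move: HN CeN; rewrite /K !mulrDl !mulrDr -/la; lra.
have Z0 : 0 <= l / v + eps * K by rewrite addr_ge0// ?divr_ge0 ?mulr_ge0// ltW.
have he0 : 0 < h + eps by rewrite addr_gt0.
apply: le_trans (ler_wpM2r _ num) _; first by rewrite invr_ge0 ltW.
apply: (@le_trans _ _ ((l / v + eps * K) / h)).
  by rewrite ler_wpM2l// lef_pV2 ?posrE// lerDl ltW.
rewrite mulrDl invfM mulrA lerD2l.
by rewrite ler_pdivrMr.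
Qed.

End SpeedBound.

(** If [v] or [h] is 0 the left side vanishes whatever [m] is, since 0 times an infinity is 0.
    Otherwise [m], whose sign is unknown, is replaced by its nonnegative bound before [s] is
    replaced by [h]. *)
Lemma mule_le_of_rate (R : realType) (s m e : \bar R) (v h : R) :
  (0 <= s)%E -> (s <= h%:E)%E -> 0 <= v -> 0 <= h -> (0 <= e)%E ->
  (forall l, 0 < v -> 0 < h -> e = l%:E -> (m <= (l / (v * h))%:E)%E) ->
  (s * v%:E * m <= e)%E.
Proof.
move=> s0 sh v0 h0 e0 me.
have [v00|vN0] := eqVneq v 0; first by rewrite v00 mule0 mul0e.
have vp : 0 < v by rewrite lt_neqAle eq_sym vN0.
have [h00|hN0] := eqVneq h 0.
  rewrite h00 in sh; have -> : s = 0%E by apply/eqP; rewrite eq_le s0 sh.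
  by rewrite !mul0e.
have hp : 0 < h by rewrite lt_neqAle eq_sym hN0.
case: e e0 me => [l| |] l0 me; [|by rewrite leey|by []].
rewrite lee_fin in l0.
have sv0 : (0 <= s * v%:E)%E by rewrite mule_ge0// lee_fin.
apply: le_trans (lee_wpmul2l sv0 (me l vp hp erefl)) _.
rewrite -muleA -EFinM; apply: le_trans (lee_wpmul2r _ sh) _.
  by rewrite lee_fin mulr_ge0// divr_ge0// mulr_ge0.
rewrite -EFinM lee_fin le_eqVlt; apply/orP; left; apply/eqP.
by field; rewrite vN0 hN0.
Qed.

Theorem theorem2 (R : realType) (A : finType) (a0 : A) (r : nat)
  (f : ('I_(2 * r).+1 -> A) -> A) (mu : probability (@Conf A a0) R)
  (vp vm : R) :
  mu_ergodic mu (@sshift A a0) ->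
  mu_invariant mu (@CA A a0 r f) ->
  0 <= vp -> 0 <= vm ->
  (h_mu mu (@sshift A a0) * (vp + vm)%:E * M_mu_v mu (@CA A a0 r f) vp vm
     <= h_mu mu (@CA A a0 r f))%E.
Proof.
move=> [invT ergT] _ vp0 vm0; apply: mule_le_of_rate.
- exact: h_mu_ge0.
- exact: h_mu_le_rate.
- exact: addr_ge0.
- exact: rate_ge0.
- exact: h_mu_ge0.
- by move=> l; exact: (M_mu_v_le (measurable_CA f) vp0 vm0 invT ergT).
Qed.
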